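(* Let $(M,\alpha_1,\alpha_2,\phi,g)$ be a normal metric contact pair with decomposable $\phi$. Then any $\phi$-invariant submanifold of $M$ of dimension $\geq 2$ is a minimal submanifold of the Riemannian manifold $(M,g)$.
   Context: All objects are smooth. A contact pair of type $(h,k)$ on a manifold $M$ of dimension $2h+2k+2$ is a pair of $1$-forms $(\alpha_1,\alpha_2)$ such that $\alpha_1\wedge(d\alpha_1)^h\wedge\alpha_2\wedge(d\alpha_2)^k$ is a volume form, $(d\alpha_1)^{h+1}=0$ and $(d\alpha_2)^{k+1}=0$. Convention: $2\,d\alpha(X,Y)=X\alpha(Y)-Y\alpha(X)-\alpha([X,Y])$ for $1$-forms. For $i=1,2$, the integrable subbundle $T\mathcal{F}_i=\{X:\alpha_i(X)=0,\ d\alpha_i(X,Y)=0\ \forall Y\}$ defines the characteristic foliation $\mathcal{F}_i$ of $\alpha_i$. The Reeb vector fields $Z_1,Z_2$ are the unique vector fields with $\alpha_i(Z_j)=\delta_{ij}$ and $i_{Z_i}d\alpha_j=0$ for all $i,j\in\{1,2\}$. A contact pair structure $(\alpha_1,\alpha_2,\phi)$ is a contact pair together with a $(1,1)$-tensor field $\phi$ with $\phi^2=-\mathrm{Id}+\alpha_1\otimes Z_1+\alpha_2\otimes Z_2$ and $\phi Z_1=\phi Z_2=0$. $\phi$ is decomposable if $\phi(T\mathcal{F}_i)\subset T\mathcal{F}_i$ for $i=1,2$. The structure is normal if both almost complex structures $J=\phi-\alpha_2\otimes Z_1+\alpha_1\otimes Z_2$ and $T=\phi+\alpha_2\otimes Z_1-\alpha_1\otimes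 Z_2$ are integrable; equivalently, $[\phi,\phi](X,Y)+2d\alpha_1(X,Y)Z_1+2d\alpha_2(X,Y)Z_2=0$ for all $X,Y$, where $[\phi,\phi]$ is the Nijenhuis tensor $[\phi,\phi](X,Y)=\phi^2[X,Y]+[\phi X,\phi Y]-\phi[\phi X,Y]-\phi[X,\phi Y]$. A metric contact pair $(M,\alpha_1,\alpha_2,\phi,g)$ is a contact pair structure with a Riemannian metric $g$ that is associated: $g(X,\phi Y)=(d\alpha_1+d\alpha_2)(X,Y)$ and $g(X,Z_i)=\alpha_i(X)$ for $i=1,2$ and all $X,Y$. A submanifold $N\subset M$ is $\phi$-invariant if $\phi(TN)\subset TN$. *)

(* Defs.v *)
(* MathComp / MathComp-Analysis. *)
From HB Require Import structures.
From mathcomp Require Import all_boot all_order all_fingroup all_algebra.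
From mathcomp Require Import all_classical all_reals all_analysis.
Set Implicit Arguments.
Unset Strict Implicit.
Unset Printing Implicit Defensive.
Import Order.TTheory GRing.Theory Num.Theory.
Import numFieldNormedType.Exports.
Local Open Scope classical_set_scope.
Local Open Scope ring_scope.

(* Conventions.  Tangent vectors are row vectors of components in a chart, and
   linear maps act on them on the right, so the matrix of a map is the transpose
   of the usual one; in particular [v *m jacobian f x] is the image of [v] under
   the differential of [f].  A 1-form has column vectors as values, and the
   tensor product of a 1-form [a] and a vector field [Z], i.e. the endomorphism
   X |-> a(X) Z, is [a *m Z]. *)

Definition pderiv (R : realType) (n : nat) (V : normedModType R) (i : 'I_n)
  (f : 'rV[R]_n -> V) (x : 'rV[R]_n) : V := 'D_(delta_mx 0 i) f x.

Fixpoint class_C (R : realType) (n : nat) (r : nat) (U : set 'rV[R]_n)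
    (f : 'rV[R]_n -> R) : Prop :=
  if r is r'.+1 then
    (forall x, U x -> {for x, continuous f}) /\
    forall i : 'I_n,
      (forall x, U x -> derivable f x (delta_mx 0 i)) /\
      class_C r' U (pderiv i f)
  else forall x, U x -> {for x, continuous f}.

(* Meant for open [U] only. *)
Definition smooth_on (R : realType) (n p q : nat) (U : set 'rV[R]_n)
    (F : 'rV[R]_n -> 'M[R]_(p, q)) : Prop :=
  forall i j r, class_C r U (fun x => F x i j).

(* [cmap c] and [cinv c] are only meaningful on [cdom c] and on its image. *)
Record smooth_manifold (R : realType) (m : nat) := SmoothManifold {
  carrier :> topologicalType ;
  chart : Type ;
  cdom : chart -> set carrier ;
  cmap : chart -> carrier -> 'rV[R]_m ;
  cinv : chart -> 'rV[R]_m -> carrier ;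
  manifold_hausdorff : hausdorff_space carrier ;
  manifold_second_countable : @second_countable carrier ;
  cdom_open : forall c, open (cdom c) ;
  cdom_cover : forall p, exists c, cdom c p ;
  cmap_open : forall c, open (cmap c @` cdom c) ;
  cmapK : forall c p, cdom c p -> cinv c (cmap c p) = p ;
  cmap_continuous : forall c p, cdom c p -> {for p, continuous (cmap c)} ;
  cinv_continuous : forall c x, (cmap c @` cdom c) x ->
    {for x, continuous (cinv c)} ;
  transition_smooth : forall c d,
    smooth_on (cmap c @` (cdom c `&` cdom d)) (cmap d \o cinv c)
}.
Arguments chart {R m} _.
Arguments cdom {R m _} c.
Arguments cmap {R m _} c.
Arguments cinv {R m _} c.

Definition cimage (R : realType) (m : nat) (M : smooth_manifold R m)
  (c : chart M) : set 'rV[R]_m := cmap c @` cdom c.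

Definition overlap (R : realType) (m : nat) (M : smooth_manifold R m)
  (c d : chart M) : set 'rV[R]_m := cmap c @` (cdom c `&` cdom d).

Definition transition (R : realType) (m : nat) (M : smooth_manifold R m)
  (c d : chart M) : 'rV[R]_m -> 'rV[R]_m := cmap d \o cinv c.

(* A smooth tensor field is given by its components in every chart, as smooth
   functions of the coordinates in that chart, subject to the transformation law
   of its type under a change of chart. *)

Record vector_field (R : realType) (m : nat) (M : smooth_manifold R m) :=
  VectorField {
  vfield_comp :> chart M -> 'rV[R]_m -> 'rV[R]_m ;
  vfield_smooth : forall c, smooth_on (cimage c) (vfield_comp c) ;
  vfield_change : forall c d x, overlap c d x ->
    vfield_comp d (transition c d x) =
    vfield_comp c x *m jacobian (transition c d) x
}.

Record one_form (R : realType) (m : nat) (M : smooth_manifold R m) := OneForm {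
  oform_comp :> chart M -> 'rV[R]_m -> 'cV[R]_m ;
  oform_smooth : forall c, smooth_on (cimage c) (oform_comp c) ;
  oform_change : forall c d x, overlap c d x ->
    oform_comp c x =
    jacobian (transition c d) x *m oform_comp d (transition c d x)
}.

(* Tensor fields of type (1,1). *)
Record endo_field (R : realType) (m : nat) (M : smooth_manifold R m) :=
  EndoField {
  endo_comp :> chart M -> 'rV[R]_m -> 'M[R]_m ;
  endo_smooth : forall c, smooth_on (cimage c) (endo_comp c) ;
  endo_change : forall c d x, overlap c d x ->
    endo_comp c x *m jacobian (transition c d) x =
    jacobian (transition c d) x *m endo_comp d (transition c d x)
}.

Definition bilin (R : realType) (m : nat) (G : 'M[R]_m) (u v : 'rV[R]_m) : R :=
  (u *m G *m v^T) 0 0.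

Record riemannian_metric (R : realType) (m : nat) (M : smooth_manifold R m) :=
  RiemannianMetric {
  metric_comp :> chart M -> 'rV[R]_m -> 'M[R]_m ;
  metric_smooth : forall c, smooth_on (cimage c) (metric_comp c) ;
  metric_change : forall c d x, overlap c d x ->
    metric_comp c x =
    jacobian (transition c d) x *m metric_comp d (transition c d x)
      *m (jacobian (transition c d) x)^T ;
  metric_sym : forall c x, cimage c x -> (metric_comp c x)^T = metric_comp c x ;
  metric_pos : forall c x, cimage c x -> forall v, v != 0 ->
    0 < bilin (metric_comp c x) v v
}.

(* Exterior forms at a point; [wedge] is only used on alternating forms.  The
   factor 1/(p+q)! goes with the factor 1/2 in the exterior derivative. *)
Definition form (R : realType) (m p : nat) : Type := ('I_p -> 'rV[R]_m) -> R.

Definition wedge (R : realType) (m p q : nat) (a : form R m p) (b : form R m q)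
    : form R m (p + q) :=
  fun v => ((p + q)`!)%:R^-1 *
    \sum_(s : 'S_(p + q))
      (-1) ^+ s * a (fun i => v (s (lshift q i)))
                * b (fun j => v (s (rshift p j))).

Fixpoint wedge_pow (R : realType) (m p : nat) (a : form R m p) (r : nat)
    : form R m (r * p) :=
  if r is r'.+1 then wedge a (@wedge_pow R m p a r') else fun=> 1.
Arguments wedge_pow {R m p} a r.

Definition ev (R : realType) (m : nat) (a : 'cV[R]_m) (v : 'rV[R]_m) : R :=
  (v *m a) 0 0.

Definition ev_form (R : realType) (m : nat) (a : 'cV[R]_m) : form R m 1 :=
  fun v => ev a (v 0).

(* 2 da(X,Y) = X a(Y) - Y a(X) - a([X,Y]), evaluated on the vector fields with
   constant components u and v, whose bracket vanishes. *)
Definition ext_d (R : realType) (m : nat) (a : 'rV[R]_m -> 'cV[R]_m)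
    (x u v : 'rV[R]_m) : R :=
  2^-1 * ('D_u (fun y => ev (a y) v) x - 'D_v (fun y => ev (a y) u) x).

Definition ext_d_form (R : realType) (m : nat) (a : 'rV[R]_m -> 'cV[R]_m)
    (x : 'rV[R]_m) : form R m 2 :=
  fun v => ext_d a x (v ord0) (v ord_max).

(* On a manifold of dimension 2h+2k+2 the first conjunct is about a form of top
   degree, which is a volume form iff it vanishes nowhere. *)
Definition contact_pair (R : realType) (m : nat) (M : smooth_manifold R m)
    (h k : nat) (a1 a2 : one_form M) : Prop :=
  forall (c : chart M) x, cimage c x ->
  [/\ exists v,
        wedge (wedge (wedge (ev_form (a1 c x))
                            (wedge_pow (ext_d_form (a1 c) x) h))
                     (ev_form (a2 c x)))
              (wedge_pow (ext_d_form (a2 c) x) k) v != 0,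
      forall v, wedge_pow (ext_d_form (a1 c) x) h.+1 v = 0
    & forall v, wedge_pow (ext_d_form (a2 c) x) k.+1 v = 0].

Definition reeb_fields (R : realType) (m : nat) (M : smooth_manifold R m)
    (a1 a2 : one_form M) (Z1 Z2 : vector_field M) : Prop :=
  forall (c : chart M) x, cimage c x ->
  [/\ [/\ ev (a1 c x) (Z1 c x) = 1, ev (a1 c x) (Z2 c x) = 0,
          ev (a2 c x) (Z1 c x) = 0 & ev (a2 c x) (Z2 c x) = 1],
      forall v, ext_d (a1 c) x (Z1 c x) v = 0,
      forall v, ext_d (a1 c) x (Z2 c x) v = 0,
      forall v, ext_d (a2 c) x (Z1 c x) v = 0
    & forall v, ext_d (a2 c) x (Z2 c x) v = 0].

(* The Reeb fields of a contact pair are determined by it, so carrying them as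
   data adds nothing to the structure. *)
Definition contact_pair_structure (R : realType) (m : nat)
    (M : smooth_manifold R m) (h k : nat) (a1 a2 : one_form M)
    (Z1 Z2 : vector_field M) (phi : endo_field M) : Prop :=
  [/\ contact_pair h k a1 a2,
      reeb_fields a1 a2 Z1 Z2
    & forall (c : chart M) x, cimage c x ->
      [/\ phi c x *m phi c x = - 1%:M + a1 c x *m Z1 c x + a2 c x *m Z2 c x,
          Z1 c x *m phi c x = 0
        & Z2 c x *m phi c x = 0]].

Definition associated_metric (R : realType) (m : nat) (M : smooth_manifold R m)
    (a1 a2 : one_form M) (Z1 Z2 : vector_field M) (phi : endo_field M)
    (g : riemannian_metric M) : Prop :=
  forall (c : chart M) x, cimage c x ->
  [/\ forall u v, bilin (g c x) u (v *m phi c x) =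
        ext_d (a1 c) x u v + ext_d (a2 c) x u v,
      forall u, bilin (g c x) u (Z1 c x) = ev (a1 c x) u
    & forall u, bilin (g c x) u (Z2 c x) = ev (a2 c x) u].

Definition metric_contact_pair (R : realType) (m : nat)
    (M : smooth_manifold R m) (h k : nat) (a1 a2 : one_form M)
    (Z1 Z2 : vector_field M) (phi : endo_field M) (g : riemannian_metric M)
    : Prop :=
  contact_pair_structure h k a1 a2 Z1 Z2 phi /\
  associated_metric a1 a2 Z1 Z2 phi g.

(* Fibre at [x] of the tangent bundle of the characteristic foliation of [a]. *)
Definition characteristic (R : realType) (m : nat) (M : smooth_manifold R m)
    (a : one_form M) (c : chart M) (x : 'rV[R]_m) : set 'rV[R]_m :=
  [set u | ev (a c x) u = 0 /\ forall v, ext_d (a c) x u v = 0].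

Definition decomposable (R : realType) (m : nat) (M : smooth_manifold R m)
    (a1 a2 : one_form M) (phi : endo_field M) : Prop :=
  forall (c : chart M) x, cimage c x -> forall u,
    (characteristic a1 c x u -> characteristic a1 c x (u *m phi c x)) /\
    (characteristic a2 c x u -> characteristic a2 c x (u *m phi c x)).

(* An almost complex structure is integrable if around every point there are
   coordinates [psi] in which its components are those of a constant complex
   structure [J0] on R^m.  Since every [J0] with [J0^2 = -1] is conjugate to the
   standard one, these are complex coordinates up to a linear change. *)
Definition integrable (R : realType) (m : nat) (M : smooth_manifold R m)
    (J : chart M -> 'rV[R]_m -> 'M[R]_m) : Prop :=
  forall (c : chart M) x, cimage c x ->
  exists (W : set 'rV[R]_m) (psi : 'rV[R]_m -> 'rV[R]_m) (J0 : 'M[R]_m),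
  [/\ open W /\ W `<=` cimage c, W x,
      [/\ smooth_on W psi, set_inj W psi
        & forall y, W y -> jacobian psi y \in unitmx],
      J0 *m J0 = - 1%:M
    & forall y, W y -> J c y *m jacobian psi y = jacobian psi y *m J0].

Definition normal_structure (R : realType) (m : nat) (M : smooth_manifold R m)
    (a1 a2 : one_form M) (Z1 Z2 : vector_field M) (phi : endo_field M) : Prop :=
  integrable (fun (c : chart M) x =>
    phi c x - a2 c x *m Z1 c x + a1 c x *m Z2 c x) /\
  integrable (fun (c : chart M) x =>
    phi c x + a2 c x *m Z1 c x - a1 c x *m Z2 c x).

Definition chart_map (R : realType) (n m : nat) (N : smooth_manifold R n)
    (M : smooth_manifold R m) (f : N -> M) (c : chart N) (d : chart M)
    : 'rV[R]_n -> 'rV[R]_m :=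
  cmap d \o f \o cinv c.

Definition chart_map_dom (R : realType) (n m : nat) (N : smooth_manifold R n)
    (M : smooth_manifold R m) (f : N -> M) (c : chart N) (d : chart M)
    : set 'rV[R]_n :=
  cmap c @` (cdom c `&` f @^-1` cdom d).

(* Immersed submanifolds; the topology of [N] may be finer than the one induced
   by [M], and embedded submanifolds are a special case. *)
Definition submanifold (R : realType) (n m : nat) (N : smooth_manifold R n)
    (M : smooth_manifold R m) (f : N -> M) : Prop :=
  [/\ injective f, continuous f,
      forall c d, smooth_on (chart_map_dom f c d) (chart_map f c d)
    & forall c d y, chart_map_dom f c d y ->
        row_free (jacobian (chart_map f c d) y)].

(* The tangent space of [f(N)] is the row space of the Jacobian. *)
Definition phi_invariant (R : realType) (n m : nat) (N : smooth_manifold R n)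
    (M : smooth_manifold R m) (f : N -> M) (phi : endo_field M) : Prop :=
  forall (c : chart N) (d : chart M) y, chart_map_dom f c d y ->
    stablemx (jacobian (chart_map f c d) y) (phi d (chart_map f c d y)).

(* The components of the Levi-Civita covariant derivative of the j-th coordinate
   field along the i-th one. *)
Definition christoffel (R : realType) (m : nat) (G : 'rV[R]_m -> 'M[R]_m)
    (x : 'rV[R]_m) (i j : 'I_m) : 'rV[R]_m :=
  \row_l (2^-1 * \sum_k invmx (G x) l k *
    (pderiv i (fun y => G y j k) x + pderiv j (fun y => G y i k) x
     - pderiv k (fun y => G y i j) x)).

(* The ambient Levi-Civita covariant derivative of the b-th coordinate field of
   a parametrised submanifold [F] along the a-th one. *)
Definition covariant_derivative (R : realType) (n m : nat)
    (G : 'rV[R]_m -> 'M[R]_m) (F : 'rV[R]_n -> 'rV[R]_m) (y : 'rV[R]_n)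
    (a b : 'I_n) : 'rV[R]_m :=
  pderiv a (pderiv b F) y +
  \sum_i \sum_j
    (pderiv a F y 0 i * pderiv b F y 0 j) *: christoffel G (F y) i j.

(* The orthogonal projection onto the normal space, as the projection along the
   tangent space <<J>> onto its orthogonal {v | v *m G *m J^T = 0}. *)
Definition normal_projection (R : realType) (n m : nat)
    (G : 'rV[R]_m -> 'M[R]_m) (F : 'rV[R]_n -> 'rV[R]_m) (y : 'rV[R]_n)
    : 'M[R]_m :=
  let J := jacobian F y in proj_mx (kermx (G (F y) *m J^T)) (<<J>>)%MS.

Definition second_fundamental_form (R : realType) (n m : nat)
    (G : 'rV[R]_m -> 'M[R]_m) (F : 'rV[R]_n -> 'rV[R]_m) (y : 'rV[R]_n)
    (a b : 'I_n) : 'rV[R]_m :=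
  covariant_derivative G F y a b *m normal_projection G F y.

Definition induced_metric (R : realType) (n m : nat)
    (G : 'rV[R]_m -> 'M[R]_m) (F : 'rV[R]_n -> 'rV[R]_m) (y : 'rV[R]_n)
    : 'M[R]_n :=
  let J := jacobian F y in J *m G (F y) *m J^T.

Definition mean_curvature (R : realType) (n m : nat)
    (G : 'rV[R]_m -> 'M[R]_m) (F : 'rV[R]_n -> 'rV[R]_m) (y : 'rV[R]_n)
    : 'rV[R]_m :=
  n%:R^-1 *: \sum_a \sum_b
    invmx (induced_metric G F y) a b *: second_fundamental_form G F y a b.

Definition minimal (R : realType) (n m : nat) (N : smooth_manifold R n)
    (M : smooth_manifold R m) (f : N -> M) (g : riemannian_metric M) : Prop :=
  forall (c : chart N) (d : chart M) y, chart_map_dom f c d y ->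
    mean_curvature (g d) (chart_map f c d) y = 0.

(* Main.v *)
From HB Require Import structures.
Require Import Defs.
From mathcomp Require Import all_boot all_order all_algebra.
From mathcomp Require Import all_classical all_reals all_analysis.
From mathcomp Require Import zify ring lra.

(** Work in charts, with [F] the local parametrisation of the submanifold, [T] its
    tangent space at a point, and [nu] a normal vector there.  Let [B] be the
    component of the second fundamental form along [nu], and [Om] the closed 2-form
    [d alpha1 + d alpha2], which is [g(., phi .)].  The submanifold is minimal when
    [B] has zero trace for every [nu].

    The endomorphism [phi] is [g]-skew, its kernel is the Reeb plane spanned by [Z1]
    and [Z2], and it is an isometric complex structure on the orthogonal of that
    plane.  Hence [T] is the orthogonal sum of [phi T], on which [phi] is a complex
    structure, and of [T] intersected with the Reeb plane.  The trace of [B]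
    vanishes as soon as [B(X,X) + B(phi X, phi X) = 0] for [X] in [phi T] and
    [B(xi,xi) = 0] for [xi] in both [T] and the Reeb plane ([trace_zero]).

    As for complex submanifolds of almost Kaehler manifolds, these two values follow
    from the invariance of the submanifold, differentiated once
    ([invariance_deriv_along]), and from the closedness of [Om].  The outcome
    ([jet_complex_line], [jet_reeb_line]) is that both are zero up to the quantity
    [alpha1(nu) D_w(alpha1(F_w)) + alpha2(nu) D_w(alpha2(F_w))], in which [w] is the
    coordinate vector mapped to [X] or to [xi], [F_w] is the image of [w] under the
    differential of [F], and [D_w] differentiates along the submanifold.

    That this quantity vanishes ([alpha_normal_along]) depends on the dimension of
    [T] intersected with the Reeb plane.  The orthogonal projection onto [T] maps
    the Reeb plane into itself, so it induces an idempotent on that plane; the trace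
    of this idempotent is the dimension in question, and it is continuous, hence
    locally constant.
    - Dimension 2: both Reeb fields are tangent, so [alpha1(nu) = alpha2(nu) = 0].
    - Dimension 0: near the point both contact forms pull back to zero, then so does
      [Om], which is absurd because [T = phi T] and [Om(X, phi X) = - g(X,X)] there.
    - Dimension 1: [alpha1 /\ alpha2] pulls back to zero, so the pulled back contact
      forms are proportional.  Differentiating this once shows that the pullbacks of
      [d alpha1] and [d alpha2] are in the same ratio; differentiating again, with
      [d(d alpha_i) = 0], shows that the ratio is stationary in the Reeb direction.
      This last step needs a nonzero [Om] on [T], that is [phi T] nonzero, and it is
      where the submanifold must have dimension at least 2: a curve in the direction
      of a varying combination of the Reeb fields need not be a geodesic. *)

Set Implicit Arguments.
Unset Strict Implicit.
Unset Printing Implicit Defensive.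
Import Order.TTheory GRing.Theory Num.Theory.
Import numFieldNormedType.Exports.
Local Open Scope classical_set_scope.
Local Open Scope ring_scope.

(** * Differentiability of continuously differentiable functions, Schwarz's theorem *)

Lemma is_derive_line (R : realType) (V : normedModType R) (f : V -> R)
    (x v : V) (t : R) :
  derivable f (x + t *: v) v ->
  is_derive t 1 (fun s : R => f (x + s *: v)) ('D_v f (x + t *: v)).
Proof.
move=> df.
have E : (fun h : R => h^-1 *:
    (((fun s : R => f (x + s *: v)) \o shift t) (h *: 1) - f (x + t *: v)))
  = (fun h : R => h^-1 *: ((f \o shift (x + t *: v)) (h *: v) - f (x + t *: v))).
  by apply/funext => h /=; rewrite [_%:A]mulr1 scalerDl addrCA.
by split; rewrite /derivable /derive E.
Qed.

(** Stated for a step [s] of any sign, so that no case distinction is left to the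
    coordinatewise arguments below. *)
Lemma line_MVT (R : realType) (V : normedModType R) (f : V -> R) (x v : V) (s : R) :
  (forall t : R, `|t| <= `|s| -> derivable f (x + t *: v) v) ->
  exists2 c, `|c| <= `|s| & f (x + s *: v) - f x = s * 'D_v f (x + c *: v).
Proof.
move=> df.
pose g := fun s : R => f (x + s *: v).
have dg (t : R) : `|t| <= `|s| -> is_derive t 1 g ('D_v f (x + t *: v)).
  by move=> ts; apply/is_derive_line/df.
have cg (a b : R) : {in `[a, b], forall t : R, `|t| <= `|s|} ->
    {within `[a, b], continuous g}.
  move=> abs; apply: derivable_within_continuous => t /abs /dg[].
  by [].
have g0 : g 0 = f x by rewrite /g scale0r addr0.
have [s0|s0] := leP 0 s.
  have abs : {in `[0, s], forall t : R, `|t| <= `|s|}.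
    by move=> t; rewrite in_itv /= => /andP[t0 ts]; rewrite !ger0_norm.
  have [|c cab E] := MVT_segment s0 (f := g)
    (df := fun t : R => 'D_v f (x + t *: v)) _ (cg _ _ abs).
    by move=> t tI; apply/dg/abs; move: tI; rewrite !in_itv /= => /andP[/ltW-> /ltW->].
  by exists c; [exact: abs | rewrite -g0 -/(g s) E subr0 mulrC].
have abs : {in `[s, 0], forall t : R, `|t| <= `|s|}.
  by move=> t; rewrite in_itv /= => /andP[t0 ts]; rewrite !ler0_norm ?lerN2 // ltW.
have [|c cab E] := MVT_segment (ltW s0) (f := g)
    (df := fun t : R => 'D_v f (x + t *: v)) _ (cg _ _ abs).
  by move=> t tI; apply/dg/abs; move: tI; rewrite !in_itv /= => /andP[/ltW-> /ltW->].
exists c; first exact: abs.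
by apply: oppr_inj; rewrite opprB -g0 -/(g s) E sub0r mulrN mulrC.
Qed.

(** The increment on the left is symmetric in [u] and [v], which is what makes the
    mixed derivatives agree in the limit. *)
Lemma schwarz_increment (R : realType) (V : normedModType R) (f : V -> R)
    (x u v : V) (s : R) :
  (forall a b : R, `|a| <= `|s| -> `|b| <= `|s| ->
     derivable f (x + a *: u + b *: v) u /\
     derivable ('D_u f) (x + a *: u + b *: v) v) ->
  exists a b : R, [/\ `|a| <= `|s|, `|b| <= `|s| &
    f (x + s *: u + s *: v) - f (x + s *: u) - f (x + s *: v) + f x =
    s ^+ 2 * 'D_v ('D_u f) (x + a *: u + b *: v)].
Proof.
move=> df.
have s0 : `|0 : R| <= `|s| by rewrite normr0.
pose g y := f (y + s *: v) - f y.
have dshift (a : R) : `|a| <= `|s| ->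
    is_derive (x + a *: u) u (fun y => f (y + s *: v)) ('D_u f (x + a *: u + s *: v)).
  move=> sa; have [d _] := df a s sa (lexx _).
  have E : (fun h : R => h^-1 *: (((fun y => f (y + s *: v)) \o shift (x + a *: u)) (h *: u) -
     f (x + a *: u + s *: v))) =
     (fun h : R => h^-1 *: ((f \o shift (x + a *: u + s *: v)) (h *: u) -
        f (x + a *: u + s *: v))).
    by apply/funext => h /=; rewrite !addrA.
  by split; rewrite /derivable /derive E.
have dg (a : R) : `|a| <= `|s| ->
    is_derive (x + a *: u) u g ('D_u f (x + a *: u + s *: v) - 'D_u f (x + a *: u)).
  move=> sa; have [d _] := df a 0 sa s0; rewrite scale0r addr0 in d.
  have H1 := dshift a sa; have H2 := derivableP d.
  exact: is_deriveB.
have [|a sa Ea] := @line_MVT _ _ g x u s; first by move=> t /dg[].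
have [|b sb Eb] := @line_MVT _ _ ('D_u f) (x + a *: u) v s.
  by move=> t ts; have [_] := df a t sa ts.
exists a, b; split=> //.
have [_ Eg] := dg a sa.
move: Ea; rewrite Eg Eb /g expr2 -mulrA => <-.
by rewrite opprB addrA [LHS]addrAC.
Qed.

Lemma eq_of_close_values (R : realType) (V : normedModType R) (A B : V -> R) (x : V) :
  {for x, continuous A} -> {for x, continuous B} ->
  (forall d : R, 0 < d -> exists p q, [/\ `|x - p| < d, `|x - q| < d & A p = B q]) ->
  A x = B x.
Proof.
move=> cA cB H; apply/eqP; rewrite -subr_eq0 -normr_le0; apply/ler_addgt0Pr => e e0.
have e20 : 0 < e / 2 by rewrite divr_gt0.
have [a /= a0 Ha] := (nbhs_normP _ _).1 ((cvgrPdist_lt _ _).1 cA _ e20).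
have [b /= b0 Hb] := (nbhs_normP _ _).1 ((cvgrPdist_lt _ _).1 cB _ e20).
have [|p [q [xp xq E]]] := H (Num.min a b); first by rewrite lt_min a0.
move: xp xq; rewrite !lt_min => /andP[/Ha/= Ap _] /andP[_ /Hb/= Bq].
rewrite add0r -(subrKA (A p)) (le_trans (ler_normD _ _))//.
by rewrite [leRHS]splitr lerD ?(ltW Ap)// E distrC ltW.
Qed.

Lemma schwarz (R : realType) (V : normedModType R) (f : V -> R) (U : set V)
    (x u v : V) :
  open U -> U x ->
  (forall y, U y -> [/\ derivable f y u, derivable f y v,
     derivable ('D_u f) y v & derivable ('D_v f) y u]) ->
  {for x, continuous ('D_v ('D_u f))} -> {for x, continuous ('D_u ('D_v f))} ->
  'D_v ('D_u f) x = 'D_u ('D_v f) x.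
Proof.
move=> oU Ux dU cvu cuv.
apply: (eq_of_close_values cvu cuv) => r r0.
have /nbhs_normP[r' /= r'0 Hr'] : nbhs x U by exact: open_nbhs_nbhs.
pose d := Num.min r r'.
have d0 : 0 < d by rewrite lt_min r0.
have dU' (y : V) : `|x - y| < d -> U y.
  by rewrite lt_min => /andP[_ /Hr'].
pose s := d / (`|u| + `|v| + 1).
have K0 : 0 < `|u| + `|v| + 1 by rewrite ltr_wpDl ?addr_ge0.
have s0 : 0 < s by rewrite divr_gt0.
have Hp (a b : R) : `|a| <= `|s| -> `|b| <= `|s| ->
   `|x - (x + a *: u + b *: v)| < d.
  move=> sa sb; rewrite opprD addrA opprD addrA subrr sub0r -opprD normrN.
  rewrite (le_lt_trans (ler_normD _ _))// !normrZ.
  rewrite (@le_lt_trans _ _ (s * (`|u| + `|v|))) //.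
    by rewrite mulrDr lerD// ler_wpM2r//; [move: sa|move: sb]; rewrite (gtr0_norm s0).
  by rewrite /s mulrAC ltr_pdivrMr // ltr_pM2l // ltrDl.
have [a b sa sb|a [b [sa sb E1]]] := @schwarz_increment _ _ f x u v s.
  by have [] := dU _ (dU' _ (Hp _ _ sa sb)).
have [b' a' sb' sa'|b' [a' [sb' sa' E2]]] := @schwarz_increment _ _ f x v u s.
  rewrite [x + _ + _]addrAC; have [_ d1 _ d2] := dU _ (dU' _ (Hp _ _ sa' sb')).
  by split; [exact: d1 | exact: d2].
exists (x + a *: u + b *: v), (x + b' *: v + a' *: u).
have dr y : `|x - y| < d -> `|x - y| < r by rewrite lt_min => /andP[].
split; first exact/dr/Hp.
  by rewrite [x + _ + _]addrAC; exact/dr/Hp.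
apply: (mulfI (lt0r_neq0 (exprn_gt0 2 s0))).
apply: (etrans (esym E1)); apply: (etrans _ E2).
by rewrite [x + _ + _]addrAC (addrAC (f _) (- _) (- _)).
Qed.

Section C1.
Variables (R : realType) (n : nat).
Implicit Types (f : 'rV[R]_n -> R) (x h : 'rV[R]_n).
Local Notation e_ i := (delta_mx 0 i : 'rV[R]_n).

Definition partial_lin f x (h : 'rV[R]_n) : R := \sum_i h 0 i * pderiv i f x.

Lemma partial_lin_is_linear f x : linear (partial_lin f x).
Proof.
move=> a u v; rewrite /partial_lin scaler_sumr -big_split; apply: eq_bigr => i _.
by rewrite !mxE mulrDl -mulrA.
Qed.
HB.instance Definition _ f x :=
  GRing.isLinear.Build R ('rV[R]_n) R _ (partial_lin f x) (partial_lin_is_linear f x).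

Lemma partial_lin_continuous f x : continuous (partial_lin f x).
Proof.
move=> y; apply: (@cvg_big _ _ _ _ _ (@add_continuous R^o) _ (nbhs y) _ _ _ (nbhs_filter y)) => i _.
exact: (@cvgMr_tmp _ _ (nbhs y) _ _ _ _ (@coord_continuous _ _ _ 0 i y)).
Qed.

(** The corners of the broken line from [0] to [h] along the coordinate axes. *)
Definition prefix_rV (k : nat) h : 'rV[R]_n := \row_i (if (i < k)%N then h 0 i else 0).

Lemma prefix_rVS h (k : 'I_n) : prefix_rV k.+1 h = prefix_rV k h + h 0 k *: e_ k.
Proof.
apply/rowP => i; rewrite !mxE /= ltnS leq_eqVlt -val_eqE /=.
have [/val_inj->|] := eqVneq (i : nat) k; last by rewrite mulr0 addr0.
by rewrite ltnn mulr1 add0r.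
Qed.

(** Going from [x] to [x + h] along the coordinate axes, the mean value theorem on
    each edge compares the increment of [f] with a partial derivative at a nearby
    point, hence with the one at [x]. *)
Lemma differentiable_C1 (U : set 'rV[R]_n) f x :
  open U -> U x -> (forall y i, U y -> derivable f y (e_ i)) ->
  (forall i, {for x, continuous (pderiv i f)}) -> differentiable f x.
Proof.
move=> oU Ux dU cU.
suff H (e : R) : 0 < e -> \forall h \near (0 : 'rV[R]_n),
    `|f (h + x) - (f x + partial_lin f x h)| <= e * `|h|.
  have E : 'd f x = partial_lin f x :> (_ -> _).
    apply: diff_unique; first exact: partial_lin_continuous.
    by apply/eqaddoP => e; exact: H.
  apply/diff_locallyP; rewrite E; split; first exact: partial_lin_continuous.
  by apply/eqaddoP => e; exact: H.
move=> e0.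
pose e' := e / n.+1%:R.
have e'0 : 0 < e' by rewrite divr_gt0.
have : \forall y \near x, U y /\ forall i, `|pderiv i f x - pderiv i f y| <= e'.
  near=> y; split; first by near: y; exact: open_nbhs_nbhs.
  move=> i; move: i; near: y; apply: filter_forall => i.
  by have /cvgrPdist_le := cU i; apply.
move=> /nbhs_normP[d /= d0 Hd].
have Nd : \forall h \near (0 : 'rV[R]_n), `|h| < d.
  apply: (@nbhs0_lt R 'rV[R]_n d d0).
near=> h.
have hd : `|h| < d.
  by near: h; exact: Nd.
have hi i : `|h 0 i| <= `|h|.
  by rewrite [leRHS]/Num.Def.normr /= mx_normrE;
    apply: (le_bigmax _ (fun ij => `|h ij.1 ij.2|) (0, i)).
have Hp (k : 'I_n) (c : R) : `|c| <= `|h 0 k| ->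
    `|x - (x + prefix_rV k h + c *: e_ k)| < d.
  move=> ck; rewrite opprD addrA opprD addrA subrr sub0r -opprD normrN.
  apply: le_lt_trans hd.
  rewrite [leLHS]/Num.Def.normr /= mx_normrE; apply/bigmax_le => // -[j i] _ /=.
  rewrite !mxE ord1 eqxx /=.
  have [->|_] := eqVneq i k; first by rewrite ltnn add0r mulr1 (le_trans ck).
  by rewrite mulr0 addr0; case: ifP => // _; rewrite normr0.
have step (k : 'I_n) : exists c : R, `|c| <= `|h 0 k| /\
   f (x + prefix_rV k.+1 h) - f (x + prefix_rV k h) =
   h 0 k * pderiv k f (x + prefix_rV k h + c *: e_ k).
  have [t tk|c ck E] := @line_MVT _ _ f (x + prefix_rV k h) (e_ k) (h 0 k).
    by apply: dU; have [] := Hd _ (Hp k t tk).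
  by exists c; split=> //; rewrite prefix_rVS addrA.
have tel : f (h + x) - f x = \sum_(k < n) (f (x + prefix_rV k.+1 h) - f (x + prefix_rV k h)).
  rewrite -(big_mkord xpredT (fun k => f (x + prefix_rV k.+1 h) - f (x + prefix_rV k h))).
  rewrite telescope_sumr // (addrC h); congr (f _ - f _).
    by congr (_ + _); apply/rowP => i; rewrite mxE ltn_ord.
  by rewrite -[LHS]addr0; congr (_ + _); apply/rowP => i; rewrite !mxE.
rewrite /= opprD addrA [X in `|X + _|]tel /partial_lin -sumrB.
rewrite (le_trans (ler_norm_sum _ _ _))//.
apply: (@le_trans _ _ (\sum_(k < n) e' * `|h|)).
  apply: ler_sum => k _; have [c [ck ->]] := step k.
  rewrite -mulrBr normrM mulrC ler_pM // distrC.
  by have [_] := Hd _ (Hp k c ck).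
rewrite sumr_const card_ord -mulrnAl ler_wpM2r // -mulr_natr /e' mulrAC.
by rewrite ler_pdivrMr // ler_pM2l // ler_nat.
Unshelve. all: by end_near. Qed.

End C1.

(** * Calculus of matrix-valued functions *)

Lemma near_open (T : topologicalType) (U P : set T) (x : T) :
  open U -> U x -> (forall y, U y -> P y) -> \forall y \near x, P y.
Proof. by move=> oU Ux UP; apply: filterS (open_nbhs_nbhs (conj oU Ux)). Qed.

Lemma continuous_near_eq (T S : topologicalType) (f g : T -> S) (x : T) :
  (\forall y \near x, f y = g y) -> {for x, continuous f} -> {for x, continuous g}.
Proof.
move=> fg; have fgx := nbhs_singleton fg.
move=> cf; suff : g y @[y --> x] --> g x by [].
rewrite -fgx; apply: cvg_trans cf; apply: near_eq_cvg.
exact: fg.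
Qed.

Lemma continuous_lin (R : realType) (T : topologicalType) (f g : T -> R) (x : T) (a : R) :
  {for x, continuous f} -> {for x, continuous g} ->
  {for x, continuous (fun y => a * f y + g y)}.
Proof.
move=> cf cg; apply: (@cvgD _ R^o); last exact: cg.
by apply: cvgMl_tmp; exact: cf.
Qed.

Section MatrixCalculus.
Variables (R : realType) (V : normedModType R).

Lemma differentiable_mx p q (F : V -> 'M[R]_(p, q)) (x : V) :
  (forall i j, differentiable (fun y => F y i j) x) -> differentiable F x.
Proof.
move=> dF.
have -> : F = (fun y => \sum_i \sum_j F y i j *: delta_mx i j).
  by apply/funext => y; exact: matrix_sum_delta.
have -> : (fun y => \sum_i \sum_j F y i j *: delta_mx i j) =
   \sum_i \sum_j (fun y => F y i j *: (delta_mx i j : 'M[R]_(p, q))).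
  apply/funext => y; rewrite fct_sumE; apply: eq_bigr => i _; by rewrite fct_sumE.
apply: differentiable_sum => i; apply: differentiable_sum => j.
exact: differentiableZl.
Qed.

Lemma differentiable_entry p q (F : V -> 'M[R]_(p, q)) (x : V) i j :
  differentiable F x -> differentiable (fun y => F y i j) x.
Proof.
move=> dF.
exact: (@differentiable_comp _ _ _ _ F (fun M : 'M[R]_(p, q) => M i j) x dF
  (differentiable_coord (F x) i j)).
Qed.

Lemma derive_entry p q (F : V -> 'M[R]_(p, q)) (x v : V) i j :
  differentiable F x -> ('D_v F x) i j = 'D_v (fun y => F y i j) x.
Proof. by move=> dF; rewrite derive_mx ?mxE//; exact: diff_derivable. Qed.

Lemma differentiable_mulmx p q r (A : V -> 'M[R]_(p, q)) (B : V -> 'M[R]_(q, r)) (x : V) :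
  differentiable A x -> differentiable B x ->
  differentiable (fun y => A y *m B y) x.
Proof.
move=> dA dB; apply: differentiable_mx => i k.
have -> : (fun y => (A y *m B y) i k) =
   \sum_j ((fun y => A y i j) * (fun y => B y j k)).
  by apply/funext => y; rewrite fct_sumE mxE.
apply: differentiable_sum => j.
by apply: differentiableM; exact: differentiable_entry.
Qed.

Lemma derive_mulmx p q r (A : V -> 'M[R]_(p, q)) (B : V -> 'M[R]_(q, r)) (x v : V) :
  differentiable A x -> differentiable B x ->
  'D_v (fun y => A y *m B y) x = 'D_v A x *m B x + A x *m 'D_v B x.
Proof.
move=> dA dB; apply/matrixP => i k.
rewrite derive_entry; last exact: differentiable_mulmx.
have -> : (fun y => (A y *m B y) i k) =
   \sum_j ((fun y => A y i j) * (fun y => B y j k)).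
  by apply/funext => y; rewrite fct_sumE mxE.
have dAe j := @diff_derivable _ _ _ _ x v (differentiable_entry i j dA).
have dBe j := @diff_derivable _ _ _ _ x v (differentiable_entry j k dB).
rewrite derive_sum; last by move=> j; apply: derivableM.
rewrite !mxE -big_split; apply: eq_bigr => j _ /=.
rewrite (deriveM (dAe j) (dBe j)) (derive_entry v i j dA) (derive_entry v j k dB) addrC.
by congr (_ + _); rewrite mulrC.
Qed.

Lemma derive_mulmxr p q r (A : V -> 'M[R]_(p, q)) (B : 'M[R]_(q, r)) (x v : V) :
  differentiable A x -> 'D_v (fun y => A y *m B) x = 'D_v A x *m B.
Proof.
move=> dA; have dB : differentiable (fun _ : V => B) x by exact: differentiable_cst.
apply: (etrans (derive_mulmx v dA dB)).
by rewrite (derive_cst B x v) mulmx0 addr0.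
Qed.

Lemma derive_mulmxl p q r (A : 'M[R]_(p, q)) (B : V -> 'M[R]_(q, r)) (x v : V) :
  differentiable B x -> 'D_v (fun y => A *m B y) x = A *m 'D_v B x.
Proof.
move=> dB; have dA : differentiable (fun _ : V => A) x by exact: differentiable_cst.
apply: (etrans (derive_mulmx v dA dB)).
by rewrite (derive_cst A x v) mul0mx add0r.
Qed.

Lemma differentiable_trmx p q (A : V -> 'M[R]_(p, q)) (x : V) :
  differentiable A x -> differentiable (fun y => (A y)^T) x.
Proof.
move=> dA; apply: differentiable_mx => i j.
have -> : (fun y => (A y)^T i j) = (fun y => A y j i) by apply/funext => y; rewrite mxE.
exact: differentiable_entry.
Qed.

Lemma derive_trmx p q (A : V -> 'M[R]_(p, q)) (x v : V) :
  differentiable A x -> 'D_v (fun y => (A y)^T) x = ('D_v A x)^T.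
Proof.
move=> dA; apply/matrixP => i j.
rewrite derive_entry; last exact: differentiable_trmx.
rewrite mxE derive_entry //; congr ('D_v _ x).
by apply/funext => y; rewrite mxE.
Qed.

Lemma derive_chain (V' W : normedModType R) (F : V -> V') (G : V' -> W) (x v : V) :
  differentiable F x -> differentiable G (F x) ->
  'D_v (fun y => G (F y)) x = 'D_('D_v F x) G (F x).
Proof.
move=> dF dG; have dGF := differentiable_comp dF dG.
by rewrite (deriveE v dGF) diff_comp // !deriveE.
Qed.

Lemma derive_linear_dir (W : normedModType R) (F : V -> W) (x u v : V) (a : R) :
  differentiable F x -> 'D_(a *: u + v) F x = a *: 'D_u F x + 'D_v F x.
Proof. by move=> dF; rewrite !deriveE // linearP. Qed.

End MatrixCalculus.

Section SmoothCalculus.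
Variables (R : realType) (n : nat).
Implicit Types (f g : 'rV[R]_n -> R) (x : 'rV[R]_n) (U : set 'rV[R]_n).
Local Notation e_ i := (delta_mx 0 i : 'rV[R]_n).

(** The class depends only on the values on an open set; [jacobian] is thereby smooth,
    since it agrees with the matrix of partial derivatives on the domain only. *)
Lemma class_C_ext (r : nat) U f g :
  open U -> (forall x, U x -> f x = g x) -> class_C r U f -> class_C r U g.
Proof.
move=> oU; elim: r f g => [|r IH] f g fg.
  move=> cf x Ux; apply: continuous_near_eq (cf x Ux).
  exact: (near_open oU Ux).
move=> [cf H]; split.
  move=> x Ux; apply: continuous_near_eq (cf x Ux).
  exact: (near_open oU Ux).
move=> i; have [df Cf] := H i; split.
  move=> x Ux; apply: near_eq_derivable (df x Ux).
  exact: (near_open oU Ux).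
apply: IH Cf => x Ux; apply: near_eq_derive; exact: (near_open oU Ux).
Qed.

Lemma class_C_differentiable U f x : open U -> U x -> class_C 2 U f -> differentiable f x.
Proof.
move=> oU Ux [cf H]; apply: (differentiable_C1 oU Ux) => [y i Uy|i].
  by have [] := H i; auto.
by have [_ [+ _]] := H i; apply.
Qed.

Lemma smooth_on_differentiable p q U (F : 'rV[R]_n -> 'M[R]_(p, q)) x :
  open U -> smooth_on U F -> U x -> differentiable F x.
Proof.
move=> oU sF Ux; apply: differentiable_mx => i j.
exact: class_C_differentiable (sF i j 2%N).
Qed.

Lemma smooth_on_pderiv p q U (F : 'rV[R]_n -> 'M[R]_(p, q)) k :
  open U -> smooth_on U F -> smooth_on U (fun x => 'D_(e_ k) F x).
Proof.
move=> oU sF i j r.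
apply: (@class_C_ext r U (pderiv k (fun y => F y i j))) => // [x Ux|].
  by rewrite derive_entry //; exact: smooth_on_differentiable sF Ux.
by have [_ /(_ k)[]] := sF i j r.+1.
Qed.

Lemma derive_row_sum (W : normedModType R) (F : 'rV[R]_n -> W) x u :
  differentiable F x -> 'D_u F x = \sum_i u 0 i *: 'D_(e_ i) F x.
Proof.
move=> dF; rewrite {1}[u]row_sum_delta deriveE // linear_sum.
by apply: eq_bigr => i _; rewrite linearZ deriveE.
Qed.

Lemma class_C_cst (r : nat) U (a : R) : class_C r U (fun=> a).
Proof.
elim: r a => [|r IH] a; first by move=> x _; exact: (@cst_continuous _ _ a x).
split; first by move=> x _; exact: (@cst_continuous _ _ a x).
move=> i; split; first by move=> x _; exact: derivable_cst.
rewrite (_ : pderiv i _ = fun=> 0) //.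
by apply/funext => x; exact: derive_cst.
Qed.

Lemma class_C_lin (r : nat) U f g (a : R) : open U ->
  class_C r U f -> class_C r U g -> class_C r U (fun x => a * f x + g x).
Proof.
move=> oU; elim: r f g => [|r IH] f g.
  by move=> cf cg x Ux; apply: continuous_lin; [exact: cf | exact: cg].
move=> [cf Hf] [cg Hg]; split.
  by move=> x Ux; apply: continuous_lin; [exact: cf | exact: cg].
move=> i; have [df Cf] := Hf i; have [dg Cg] := Hg i.
have E : (fun x => a * f x + g x) = a \*: f + g by [].
split.
  move=> x Ux; rewrite E; apply: derivableD; last exact: dg.
  by apply: derivableZ; exact: df.
apply: class_C_ext (IH _ _ Cf Cg) => // x Ux.
rewrite /pderiv E deriveD; [|by apply: derivableZ; exact: df|exact: dg].
by rewrite deriveZ //; exact: df.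
Qed.

Lemma smooth_on_derive p q U (F : 'rV[R]_n -> 'M[R]_(p, q)) u :
  open U -> smooth_on U F -> smooth_on U (fun x => 'D_u F x).
Proof.
move=> oU sF i j r.
apply: (@class_C_ext r U (fun x => \sum_k u 0 k * ('D_(e_ k) F x) i j)) => // [x Ux|].
  rewrite (derive_row_sum u (smooth_on_differentiable oU sF Ux)) summxE.
  by apply: eq_bigr => k _; rewrite mxE.
elim: (index_enum _) => [|k s IH].
  rewrite (_ : (fun _ => _) = fun=> 0); first exact: class_C_cst.
  by apply/funext => x; rewrite big_nil.
rewrite (_ : (fun _ => _) = fun x => u 0 k * ('D_(e_ k) F x) i j +
    \sum_(l <- s) u 0 l * ('D_(e_ l) F x) i j).
  by apply: class_C_lin => //; exact: smooth_on_pderiv.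
by apply/funext => x; rewrite big_cons.
Qed.

Lemma derive_entry_ext p q U (F : 'rV[R]_n -> 'M[R]_(p, q)) x u v i j :
  open U -> smooth_on U F -> U x ->
  ('D_v (fun y => 'D_u F y) x) i j = 'D_v ('D_u (fun y => F y i j)) x.
Proof.
move=> oU sF Ux.
rewrite derive_entry; last exact: smooth_on_differentiable (smooth_on_derive _ _ sF) Ux.
apply: near_eq_derive; apply: (near_open oU Ux) => y Uy.
by rewrite derive_entry //; exact: smooth_on_differentiable sF Uy.
Qed.

Lemma derive_comm p q U (F : 'rV[R]_n -> 'M[R]_(p, q)) x u v :
  open U -> smooth_on U F -> U x ->
  'D_v (fun y => 'D_u F y) x = 'D_u (fun y => 'D_v F y) x.
Proof.
move=> oU sF Ux; apply/matrixP => i j.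
have E1 := derive_entry_ext u v i j oU sF Ux.
have E2 := derive_entry_ext v u i j oU sF Ux.
apply: (etrans E1); apply: (etrans _ (esym E2)).
move=> {E1 E2}.
have sf w w' y : U y -> [/\ derivable (fun y => F y i j) y w,
    derivable ('D_w (fun y => F y i j)) y w' &
    {for y, continuous ('D_w' ('D_w (fun y => F y i j)))}].
  move=> Uy.
  have E1 z : U z -> ('D_w F z) i j = 'D_w (fun y => F y i j) z.
    by move=> Uz; rewrite derive_entry //; exact: smooth_on_differentiable sF Uz.
  have s1 := smooth_on_derive w oU sF.
  have s2 := smooth_on_derive w' oU s1.
  split.
  - exact/diff_derivable/differentiable_entry/(smooth_on_differentiable oU sF).
  - apply: (@near_eq_derivable _ _ _ (fun z => ('D_w F z) i j)).
      by apply: (near_open oU Uy) => z /E1.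
    exact/diff_derivable/differentiable_entry/(smooth_on_differentiable oU s1).
  - have E2 z : U z -> ('D_w' (fun z => 'D_w F z) z) i j = 'D_w' ('D_w (fun y => F y i j)) z.
      by move=> Uz; exact: (derive_entry_ext w w' i j oU sF Uz).
    have C0 : {for y, continuous (fun z => ('D_w' (fun z => 'D_w F z) z) i j)} := s2 i j 0%N y Uy.
    apply: continuous_near_eq C0.
    exact: (near_open oU Uy E2).
apply: (schwarz oU Ux) => [y Uy||].
- have [d1 d2 _] := sf u v y Uy; have [d3 d4 _] := sf v u y Uy; split=> //.
- by have [] := sf u v x Ux.
- by have [] := sf v u x Ux.
Qed.

End SmoothCalculus.

Section MatrixContinuity.
Variables (R : realType) (T : topologicalType).

Lemma cvg_mxP (F : set_system T) p q (A : T -> 'M[R]_(p, q)) (B : 'M[R]_(p, q)) :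
  Filter F ->
  (forall i j, A x i j @[x --> F] --> B i j) -> A x @[x --> F] --> B.
Proof.
move=> FF cA; apply/cvgrPdist_le => e e0.
near=> x.
rewrite [leLHS]/Num.Def.normr /= mx_normrE; apply/bigmax_le => [|[i j] _ /=]; first exact: ltW.
rewrite !mxE; move: i j; near: x.
apply: filter_forall => i; apply: filter_forall => j.
by have /cvgrPdist_le := cA i j; apply.
Unshelve. all: by end_near. Qed.

Lemma cvg_mx_entry (F : set_system T) p q (A : T -> 'M[R]_(p, q)) (B : 'M[R]_(p, q)) i j :
  A x @[x --> F] --> B -> A x i j @[x --> F] --> B i j.
Proof.
by move=> cA; exact: (cvg_comp _ _ cA (@coord_continuous _ _ _ i j B)).
Qed.

Lemma cvg_sumR (F : set_system T) (I : Type) (s : seq I) (P : pred I)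
    (f : I -> T -> R) (a : I -> R) :
  Filter F -> (forall i, P i -> f i x @[x --> F] --> a i) ->
  \sum_(i <- s | P i) f i x @[x --> F] --> \sum_(i <- s | P i) a i.
Proof. by move=> FF; apply: (@cvg_big _ _ _ _ _ (@add_continuous R^o)). Qed.

Lemma cvg_prodR (F : set_system T) (I : Type) (s : seq I) (P : pred I)
    (f : I -> T -> R) (a : I -> R) :
  Filter F -> (forall i, P i -> f i x @[x --> F] --> a i) ->
  \prod_(i <- s | P i) f i x @[x --> F] --> \prod_(i <- s | P i) a i.
Proof. by move=> FF; apply: (@cvg_big _ _ _ _ _ (@mul_continuous R)). Qed.

Lemma cvg_mulmx (F : set_system T) p q r (A : T -> 'M[R]_(p, q)) (B : T -> 'M[R]_(q, r))
    (A0 : 'M[R]_(p, q)) (B0 : 'M[R]_(q, r)) :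
  Filter F ->
  A x @[x --> F] --> A0 -> B x @[x --> F] --> B0 -> A x *m B x @[x --> F] --> A0 *m B0.
Proof.
move=> FF cA cB; apply: cvg_mxP => i j.
rewrite mxE (_ : (fun x => _) = fun x => \sum_k A x i k * B x k j); last first.
  by apply/funext => x; rewrite mxE.
by apply: cvg_sumR => k _; apply: cvgM; exact: cvg_mx_entry.
Qed.

Lemma cvg_trmx (F : set_system T) p q (A : T -> 'M[R]_(p, q)) (A0 : 'M[R]_(p, q)) :
  Filter F -> A x @[x --> F] --> A0 -> (A x)^T @[x --> F] --> A0^T.
Proof.
move=> FF cA; apply: cvg_mxP => i j.
rewrite mxE (_ : (fun x => _) = fun x => A x j i); last by apply/funext => x; rewrite mxE.
exact: cvg_mx_entry.
Qed.

Lemma cvg_det (F : set_system T) p (A : T -> 'M[R]_p) (A0 : 'M[R]_p) :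
  Filter F -> A x @[x --> F] --> A0 -> \det (A x) @[x --> F] --> \det A0.
Proof.
move=> FF cA; apply: cvg_sumR => s _; apply: cvgMl_tmp.
by apply: cvg_prodR => i _; exact: cvg_mx_entry.
Qed.

(** By Cramer's formula. *)
Lemma cvg_invmx (F : set_system T) p (A : T -> 'M[R]_p) (A0 : 'M[R]_p) :
  Filter F -> A0 \in unitmx -> (\forall x \near F, A x \in unitmx) ->
  A x @[x --> F] --> A0 -> invmx (A x) @[x --> F] --> invmx A0.
Proof.
move=> FF uA0 uA cA.
have d0 : \det A0 != 0 by rewrite -unitfE -unitmxE.
have cd := cvgV d0 (cvg_det FF cA).
apply: (@cvg_trans _ ((\det (A x))^-1 *: \adj (A x) @[x --> F])).
  apply: near_eq_cvg; apply: filterS uA => x ux; by rewrite /invmx ux.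
rewrite /invmx uA0; apply: cvgZ; first exact: cd.
apply: cvg_mxP => i j.
rewrite mxE (_ : (fun x => _) = fun x => cofactor (A x) j i); last
  by apply/funext => x; rewrite mxE.
apply: cvgMl_tmp; apply: cvg_det; apply: cvg_mxP => k l.
rewrite !mxE (_ : (fun x => _) = fun x => A x (lift j k) (lift i l)).
  exact: cvg_mx_entry.
by apply/funext => x; rewrite !mxE.
Qed.

End MatrixContinuity.

(** As [B] vanishes at [x], the increment of the product is [A(x + h v) B(x + h v)],
    and continuity of [A] is enough.  This is how the invariance of the tangent
    spaces is differentiated without differentiating the endomorphism induced by
    [phi]. *)
Lemma derive_mulmx_zero (R : realType) (V : normedModType R) p q r
    (A : V -> 'M[R]_(p, q)) (B : V -> 'M[R]_(q, r)) (x v : V) :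
  {for x, continuous A} -> differentiable B x -> B x = 0 ->
  'D_v (fun y => A y *m B y) x = A x *m 'D_v B x.
Proof.
move=> cA dB B0; apply: cvg_lim => //.
have cB : h^-1 *: (B (h *: v + x) - B x) @[h --> 0^'] --> 'D_v B x.
  exact: (@diff_derivable _ _ _ _ x v dB).
have cA' : A (h *: v + x) @[h --> 0^'] --> A x.
  have cl : (h *: v + x) @[h --> (0 : R)^'] --> x.
    rewrite -[X in _ --> X]add0r -[X in _ --> X + _](scale0r v).
    apply: cvgD; last exact: cvg_cst.
    by apply: cvgZr_tmp; exact: nbhs_dnbhs.
  exact: cvg_comp cl cA.
have := cvg_mulmx (dnbhs_filter (0 : R)) cA' cB.
apply: cvg_trans; apply: near_eq_cvg; near=> h => /=.
by rewrite /= B0 mulmx0 !subr0 -scalemxAr.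
Unshelve. all: by end_near. Qed.

(** * Bilinear forms, exterior derivatives and first-order jets of contact structures *)

Section Bilinear.
Variables (R : realType) (m : nat).
Implicit Types (A B G : 'M[R]_m) (a b : 'cV[R]_m) (u v w : 'rV[R]_m).

Lemma bilinDl G u v w : bilin G (u + v) w = bilin G u w + bilin G v w.
Proof. by rewrite /bilin !mulmxDl mxE. Qed.
Lemma bilinDr G u v w : bilin G u (v + w) = bilin G u v + bilin G u w.
Proof. by rewrite /bilin linearD mulmxDr mxE. Qed.
Lemma bilinZl G c u v : bilin G (c *: u) v = c * bilin G u v.
Proof. by rewrite /bilin -!scalemxAl mxE. Qed.
Lemma bilinZr G c u v : bilin G u (c *: v) = c * bilin G u v.
Proof. by rewrite /bilin linearZ /= -scalemxAr mxE. Qed.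
Lemma bilinNl G u v : bilin G (- u) v = - bilin G u v.
Proof. by rewrite -scaleN1r bilinZl mulN1r. Qed.
Lemma bilinNr G u v : bilin G u (- v) = - bilin G u v.
Proof. by rewrite -scaleN1r bilinZr mulN1r. Qed.
Lemma bilin0l G v : bilin G 0 v = 0.
Proof. by rewrite /bilin !mul0mx mxE. Qed.
Lemma bilin0r G v : bilin G v 0 = 0.
Proof. by rewrite /bilin trmx0 mulmx0 mxE. Qed.
Lemma bilin_mxD A B u v : bilin (A + B) u v = bilin A u v + bilin B u v.
Proof. by rewrite /bilin mulmxDr mulmxDl mxE. Qed.
Lemma bilin_mxZ c A u v : bilin (c *: A) u v = c * bilin A u v.
Proof. by rewrite /bilin -scalemxAr -scalemxAl mxE. Qed.
Lemma bilin_mull A G u v : bilin (A *m G) u v = bilin G (u *m A) v.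
Proof. by rewrite /bilin !mulmxA. Qed.
Lemma bilin_multr A G u v : bilin (G *m A^T) u v = bilin G u (v *m A).
Proof. by rewrite /bilin trmx_mul !mulmxA. Qed.
Lemma bilin_tr G u v : bilin G^T u v = bilin G v u.
Proof.
rewrite /bilin -[u in LHS]trmxK -trmx_mul -[v^T in LHS]/(v^T) -trmx_mul mxE.
by rewrite mulmxA.
Qed.
Lemma bilin_sym G u v : G^T = G -> bilin G u v = bilin G v u.
Proof. by move=> E; rewrite -bilin_tr E. Qed.
Lemma bilin_col a b u v : bilin (a *m b^T) u v = ev a u * ev b v.
Proof.
rewrite /bilin /ev mulmxA -mulmxA -trmx_mul.
by rewrite [LHS]mxE big_ord1 [X in _ * X]mxE.
Qed.
Lemma evD a u v : ev a (u + v) = ev a u + ev a v.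
Proof. by rewrite /ev mulmxDl mxE. Qed.
Lemma evZ a c u : ev a (c *: u) = c * ev a u.
Proof. by rewrite /ev -scalemxAl mxE. Qed.
Lemma ev0 a : ev a 0 = 0.
Proof. by rewrite /ev mul0mx mxE. Qed.
Lemma row_mul11 (c : 'rV[R]_1) v : c *m v = c 0 0 *: v.
Proof. by apply/rowP => i; rewrite !mxE big_ord1. Qed.

Lemma bilin_inj A B : (forall u v, bilin A u v = bilin B u v) -> A = B.
Proof.
move=> E; apply/matrixP => i j.
have H C : bilin C (delta_mx 0 i) (delta_mx 0 j) = C i j.
  by rewrite /bilin -rowE trmx_delta -colE !mxE.
by rewrite -!H.
Qed.

Lemma bilin_suml G (I : finType) (f : I -> 'rV[R]_m) v :
  bilin G (\sum_i f i) v = \sum_i bilin G (f i) v.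
Proof. by rewrite /bilin !mulmx_suml summxE. Qed.
Lemma row_expand (f : 'rV[R]_m -> R) (v : 'rV[R]_m) :
  (forall s t : 'rV[R]_m, f (s + t) = f s + f t) ->
  (forall c (s : 'rV[R]_m), f (c *: s) = c * f s) ->
  f v = \sum_i v 0 i * f (delta_mx 0 i).
Proof.
move=> fD fZ; have f0 : f 0 = 0 by rewrite -(scale0r 0) fZ mul0r.
rewrite {1}[v]row_sum_delta (big_morph f fD f0).
by apply: eq_bigr => i _; rewrite fZ.
Qed.
End Bilinear.

Section ExteriorDerivative.
Variables (R : realType) (m : nat) (E : set 'rV[R]_m) (a : 'rV[R]_m -> 'cV[R]_m).
Hypotheses (oE : open E) (sa : smooth_on E a).

(** The matrix of the exterior derivative, with its factor 1/2. *)
Definition dform x : 'M[R]_m := \matrix_(i, j)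
  (2^-1 * (('D_(delta_mx 0 i) a x) j 0 - ('D_(delta_mx 0 j) a x) i 0)).

Lemma derive_ev x u v : E x ->
  'D_u (fun y => ev (a y) v) x = ev ('D_u a x) v.
Proof.
move=> Ex; have da := smooth_on_differentiable oE sa Ex.
have dv : differentiable (fun _ : 'rV[R]_m => v) x by exact: differentiable_cst.
have := derive_entry u 0 0 (differentiable_mulmx dv da).
by rewrite derive_mulmx // derive_cst mul0mx add0r => <-.
Qed.

Lemma ext_dE x u v : E x ->
  ext_d a x u v = 2^-1 * (ev ('D_u a x) v - ev ('D_v a x) u).
Proof. by move=> Ex; rewrite /ext_d !derive_ev. Qed.

Lemma ext_d_skew x u v : E x -> ext_d a x u v = - ext_d a x v u.
Proof. by move=> Ex; rewrite (ext_dE u v Ex) (ext_dE v u Ex) -mulrN opprB. Qed.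

Lemma bilin_dform x u v : E x -> bilin (dform x) u v = ext_d a x u v.
Proof.
move=> Ex; rewrite ext_dE //.
have da := smooth_on_differentiable oE sa Ex.
have Hev s t : ev ('D_s a x) t = \sum_i \sum_j s 0 i * t 0 j * ('D_(delta_mx 0 i) a x) j 0.
  rewrite derive_row_sum // /ev mulmx_sumr summxE; apply: eq_bigr => i _.
  rewrite -scalemxAr mxE mxE mulr_sumr; apply: eq_bigr => j _.
  by rewrite mulrA.
rewrite (Hev u v) (Hev v u) [X in _ - X]exchange_big /= -sumrB mulr_sumr.
rewrite /bilin mxE.
under eq_bigr => j _ do rewrite mxE mulr_suml.
rewrite exchange_big /=; apply: eq_bigr => i _.
rewrite -sumrB mulr_sumr; apply: eq_bigr => j _.
rewrite !mxE; ring.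
Qed.

Lemma smooth_dform : smooth_on E dform.
Proof.
move=> i j r.
have H k l : class_C r E (fun x => ('D_(delta_mx 0 k) a x) l 0).
  exact: smooth_on_derive.
have := class_C_lin (- 2^-1) oE (H j i) (class_C_lin 2^-1 oE (H i j) (class_C_cst r E 0)).
apply: class_C_ext => // x _; rewrite mxE; ring.
Qed.

(** [d(d a) = 0]: the six second derivatives cancel in pairs. *)
Lemma dform_closed x u v w : E x ->
  bilin ('D_w dform x) u v + bilin ('D_u dform x) v w + bilin ('D_v dform x) w u = 0.
Proof.
move=> Ex.
(* Abstracting the second derivatives keeps the cancellation purely linear. *)
pose S s t r := ev ('D_s (fun y => 'D_t a y) x) r.
have Ssym s t r : S s t r = S t s r.
  exact: (congr1 (fun z => ev z r) (derive_comm t s oE sa Ex)).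
have H s t r : bilin ('D_s dform x) t r = 2^-1 * (S s t r - S s r t).
  have dd := smooth_on_differentiable oE smooth_dform Ex.
  have dc p q (A : 'M[R]_(p, q)) : differentiable (fun _ : 'rV[R]_m => A) x.
    exact: differentiable_cst.
  have -> : bilin ('D_s dform x) t r = 'D_s (fun y => bilin (dform y) t r) x.
    rewrite -(derive_entry s 0 0
      (differentiable_mulmx (differentiable_mulmx (dc _ _ t) dd) (dc _ _ r^T))).
    rewrite derive_mulmx //; last exact: differentiable_mulmx.
    by rewrite derive_mulmx // !derive_cst mul0mx add0r mulmx0 addr0.
  have -> : 'D_s (fun y => bilin (dform y) t r) x =
    'D_s (2^-1 \*: ((fun y => ev ('D_t a y) r) - (fun y => ev ('D_r a y) t))) x.
    apply: near_eq_derive; apply: (near_open oE Ex) => y Ey.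
    by rewrite bilin_dform // ext_dE.
  have dD p q : differentiable (fun y => ev ('D_p a y) q) x.
    have dp := smooth_on_differentiable oE (smooth_on_derive p oE sa) Ex.
    exact: (differentiable_entry 0 0 (differentiable_mulmx (dc _ _ q) dp)).
  have DD p q : 'D_s (fun y => ev ('D_p a y) q) x = S s p q.
    rewrite /S.
    have dp := smooth_on_differentiable oE (smooth_on_derive p oE sa) Ex.
    rewrite -(derive_entry s 0 0
      (differentiable_mulmx (dc _ _ q) dp)).
    by rewrite derive_mulmx // derive_cst mul0mx add0r.
  rewrite deriveZ; last by apply: derivableB; exact: diff_derivable.
  rewrite deriveB; [|exact: diff_derivable|exact: diff_derivable].
  by congr (_ * (_ - _)); exact: DD.
clearbody S.
apply: (etrans (congr2 +%R (congr2 +%R (H w u v) (H u v w)) (H v w u))).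
rewrite (Ssym w u) (Ssym v w) (Ssym u v); lra.
Qed.

End ExteriorDerivative.

(** The values and first derivatives at one point of the tensors of a metric contact
    pair: [jW1] and [jW2] stand for [d alpha1] and [d alpha2], and [jdX w] for the
    derivative in the direction [w] of the tensor whose value is [jX].  Treating
    derivatives as independent variables subject to linear relations makes every
    pointwise tensor identity a matter of linear arithmetic.  The field [jd_metric]
    is the derivative of [g(u,v) = Om(phi u, v) + alpha1(u) alpha1(v) +
    alpha2(u) alpha2(v)]. *)
Record contact_jet (R : realType) (m : nat) := ContactJet {
  jG : 'M[R]_m ; jP : 'M[R]_m ;
  ja1 : 'cV[R]_m ; ja2 : 'cV[R]_m ; jZ1 : 'rV[R]_m ; jZ2 : 'rV[R]_m ;
  jW1 : 'M[R]_m ; jW2 : 'M[R]_m ;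
  jdG : 'rV[R]_m -> 'M[R]_m ; jdP : 'rV[R]_m -> 'M[R]_m ;
  jda1 : 'rV[R]_m -> 'cV[R]_m ; jda2 : 'rV[R]_m -> 'cV[R]_m ;
  jdW1 : 'rV[R]_m -> 'M[R]_m ; jdW2 : 'rV[R]_m -> 'M[R]_m ;
  jG_sym : forall u v, bilin jG u v = bilin jG v u ;
  jG_pos : forall v, v != 0 -> 0 < bilin jG v v ;
  ja_reeb : [/\ ev ja1 jZ1 = 1, ev ja1 jZ2 = 0, ev ja2 jZ1 = 0 & ev ja2 jZ2 = 1] ;
  jW_reeb : forall v, [/\ bilin jW1 jZ1 v = 0, bilin jW1 jZ2 v = 0,
    bilin jW2 jZ1 v = 0 & bilin jW2 jZ2 v = 0] ;
  jP_sqr : forall u, u *m jP *m jP = - u + ev ja1 u *: jZ1 + ev ja2 u *: jZ2 ;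
  jP_reeb : jZ1 *m jP = 0 /\ jZ2 *m jP = 0 ;
  jG_assoc : forall u v, bilin jG u (v *m jP) = bilin jW1 u v + bilin jW2 u v ;
  jG_reeb : forall u, bilin jG u jZ1 = ev ja1 u /\ bilin jG u jZ2 = ev ja2 u ;
  jWE : forall u v, bilin jW1 u v = 2^-1 * (ev (jda1 u) v - ev (jda1 v) u) /\
    bilin jW2 u v = 2^-1 * (ev (jda2 u) v - ev (jda2 v) u) ;
  jdG_lin : forall c x y u v, bilin (jdG (c *: x + y)) u v =
    c * bilin (jdG x) u v + bilin (jdG y) u v ;
  jdG_sym : forall w u v, bilin (jdG w) u v = bilin (jdG w) v u ;
  jdW_skew : forall w u v, bilin (jdW1 w) u v = - bilin (jdW1 w) v u /\
    bilin (jdW2 w) u v = - bilin (jdW2 w) v u ;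
  jdW_closed : forall u v w,
    bilin (jdW1 w) u v + bilin (jdW1 u) v w + bilin (jdW1 v) w u = 0 /\
    bilin (jdW2 w) u v + bilin (jdW2 u) v w + bilin (jdW2 v) w u = 0 ;
  jd_assoc : forall w u v, bilin (jdG w) u (v *m jP) + bilin jG u (v *m jdP w) =
    bilin (jdW1 w) u v + bilin (jdW2 w) u v ;
  jd_metric : forall w u v, bilin (jdG w) u v =
    bilin (jdW1 w) (u *m jP) v + bilin (jdW2 w) (u *m jP) v +
    bilin jG (u *m jdP w) (v *m jP) +
    (ev (jda1 w) u * ev ja1 v + ev ja1 u * ev (jda1 w) v) +
    (ev (jda2 w) u * ev ja2 v + ev ja2 u * ev (jda2 w) v)
}.

Section JetAlgebra.
Variables (R : realType) (m : nat) (j : contact_jet R m).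
Implicit Types u v w X nu : 'rV[R]_m.
Local Notation g := (bilin (jG j)).
Local Notation P := (jP j).
Local Notation al1 := (ev (ja1 j)).
Local Notation al2 := (ev (ja2 j)).

(** The Christoffel symbols of the first kind. *)
Definition jgamma u v w : R := 2^-1 *
  (bilin (jdG j u) v w + bilin (jdG j v) u w - bilin (jdG j w) u v).

Lemma jgammaDl u v w s : jgamma (u + v) w s = jgamma u w s + jgamma v w s.
Proof.
have := jdG_lin j 1 u v; rewrite scale1r => L.
rewrite /jgamma !L !bilinDl; ring.
Qed.
Lemma jgammaZl c v w s : jgamma (c *: v) w s = c * jgamma v w s.
Proof.
have L0 p q : bilin (jdG j 0) p q = 0.
  by have := jdG_lin j (-1) 0 0 p q; rewrite scaler0 addr0 => {1}->; ring.
have L p q : bilin (jdG j (c *: v)) p q = c * bilin (jdG j v) p q.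
  by have := jdG_lin j c v 0 p q; rewrite addr0 L0 addr0.
rewrite /jgamma !L !bilinZl; ring.
Qed.
Lemma jgamma_sym u v s : jgamma u v s = jgamma v u s.
Proof. rewrite /jgamma [bilin _ v u](jdG_sym j); ring. Qed.
Lemma jgammaDr u v w s : jgamma u v (w + s) = jgamma u v w + jgamma u v s.
Proof.
have := jdG_lin j 1 w s; rewrite scale1r => L.
rewrite /jgamma !L !bilinDr; ring.
Qed.
Lemma jgammaZr c u v w : jgamma u v (c *: w) = c * jgamma u v w.
Proof.
have L0 p q : bilin (jdG j 0) p q = 0.
  by have := jdG_lin j (-1) 0 0 p q; rewrite scaler0 addr0 => {1}->; ring.
have L p q : bilin (jdG j (c *: w)) p q = c * bilin (jdG j w) p q.
  by have := jdG_lin j c w 0 p q; rewrite addr0 L0 addr0.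
rewrite /jgamma !L !bilinZr; ring.
Qed.

Lemma jW_skew u v : bilin (jW1 j) u v = - bilin (jW1 j) v u /\
  bilin (jW2 j) u v = - bilin (jW2 j) v u.
Proof. by have [-> ->] := jWE j u v; have [-> ->] := jWE j v u; split; lra. Qed.

Lemma jP_skew u v : g (u *m P) v = - g u (v *m P).
Proof.
rewrite jG_sym !jG_assoc; have [-> ->] := jW_skew u v; lra.
Qed.

Lemma ja_P u : al1 (u *m P) = 0 /\ al2 (u *m P) = 0.
Proof.
have [<- <-] := jG_reeb j (u *m P); have [z1 z2] := jP_reeb j.
by rewrite !jP_skew z1 z2 bilin0r oppr0.
Qed.

Lemma jG_sqr u v : g u (v *m P *m P) = - g u v + al1 v * al1 u + al2 v * al2 u.
Proof.
by rewrite jP_sqr !bilinDr bilinNr !bilinZr; have [-> ->] := jG_reeb j u.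
Qed.

Lemma jW_reeb_comb c1 c2 v :
  bilin (jW1 j) (c1 *: jZ1 j + c2 *: jZ2 j) v = 0 /\
  bilin (jW2 j) (c1 *: jZ1 j + c2 *: jZ2 j) v = 0.
Proof.
have [h1 h2 h3 h4] := jW_reeb j v.
by rewrite !bilinDl !bilinZl h1 h2 h3 h4 !mulr0 addr0.
Qed.

Lemma al_reeb_comb c1 c2 : al1 (c1 *: jZ1 j + c2 *: jZ2 j) = c1 /\
  al2 (c1 *: jZ1 j + c2 *: jZ2 j) = c2.
Proof.
have [h1 h2 h3 h4] := ja_reeb j.
by rewrite !evD !evZ h1 h2 h3 h4; split; ring.
Qed.

Lemma g_reeb_comb c1 c2 u : g u (c1 *: jZ1 j + c2 *: jZ2 j) = c1 * al1 u + c2 * al2 u.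
Proof. by rewrite bilinDr !bilinZr; have [-> ->] := jG_reeb j u. Qed.

Lemma P_reeb_comb c1 c2 : (c1 *: jZ1 j + c2 *: jZ2 j) *m P = 0.
Proof.
have [z1 z2] := jP_reeb j.
by rewrite mulmxDl -!scalemxAl z1 z2 !scaler0 addr0.
Qed.

Lemma reeb_of_kerP u : u *m P = 0 -> u = al1 u *: jZ1 j + al2 u *: jZ2 j.
Proof.
move=> uP; have := jP_sqr j u; rewrite uP mul0mx => /esym/eqP.
by rewrite -addrA addrC subr_eq0 => /eqP ->.
Qed.

(** The case of a tangent vector [X] in the image of [phi].  Here [h11], [h12] and [h22]
    are the second derivatives of the parametrisation in the directions of [X] and
    [phi X]; the first two equations are the derivative of the invariance in these
    directions, against [nu] and against [phi nu].  Eliminating [h12] expresses the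
    normal part of [h11 + h22] by [alpha1(h11)], [alpha2(h11)] and derivatives of
    [phi]; these and the derivatives of [g] combine into [d Om] evaluated at [X],
    [phi X] and [nu]. *)
Lemma jet_complex_line X nu h11 h12 h22 :
  al1 X = 0 -> al2 X = 0 ->
  - g h12 (nu *m P) + g (X *m jdP j (X *m P)) nu = g h22 nu ->
  - g h11 (nu *m P *m P) + g (X *m jdP j X) (nu *m P) = g h12 (nu *m P) ->
  al1 nu * (al1 h11 + ev (jda1 j X) X) + al2 nu * (al2 h11 + ev (jda2 j X) X) = 0 ->
  (g h11 nu + jgamma X X nu) + (g h22 nu + jgamma (X *m P) (X *m P) nu) = 0.
Proof.
move=> X1 X2 I1 I2 A; rewrite jG_sqr in I2.
have m1 := jd_metric j X X nu.
have m2 := jd_metric j nu X X.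
have s1 := jd_assoc j (X *m P) nu X.
have s2 := jd_assoc j nu (X *m P) X.
have [c1 c2] := jdW_closed j X (X *m P) nu.
have [k1 k2] := jdW_skew j nu X (X *m P).
have [k3 k4] := jdW_skew j X nu (X *m P).
have e1 := jdG_sym j (X *m P) nu (X *m P).
have e2 := jG_sym j nu (X *m jdP j (X *m P)).
have e3 := jG_sym j (X *m jdP j nu) (X *m P).
rewrite /jgamma.
rewrite X1 X2 in m1 m2.
lra.
Qed.

(** The case of a tangent vector in the Reeb plane, which [phi] kills: the invariance
    differentiated in its own direction determines the normal part of [h] up to
    [alpha1(h)] and [alpha2(h)], and the exterior derivatives vanish on [xi]. *)
Lemma jet_reeb_line c1 c2 nu h :
  let xi := c1 *: jZ1 j + c2 *: jZ2 j in
  - g h (nu *m P *m P) + g (xi *m jdP j xi) (nu *m P) = 0 ->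
  al1 nu * (al1 h + ev (jda1 j xi) xi) + al2 nu * (al2 h + ev (jda2 j xi) xi) = 0 ->
  g h nu + jgamma xi xi nu = 0.
Proof.
move=> xi I A; rewrite jG_sqr in I.
have xiP : xi *m P = 0 := P_reeb_comb c1 c2.
have [a1 a2] := al_reeb_comb c1 c2; rewrite -/xi in a1 a2.
have m1 := jd_metric j xi xi nu.
have m2 := jd_metric j nu xi xi.
have [w1 w2] := jW_reeb_comb c1 c2 nu; rewrite -/xi in w1 w2.
have [v1 v2] := jWE j xi nu.
rewrite xiP !bilin0l ?bilin0r a1 a2 in m1 m2.
rewrite /jgamma.
(* [d alpha_i (xi, nu) = 0] exchanges the two directions of derivation. *)
have d1 : ev (jda1 j xi) nu = ev (jda1 j nu) xi by lra.
have d2 : ev (jda2 j xi) nu = ev (jda2 j nu) xi by lra.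
rewrite d1 d2 in m1.
lra.
Qed.

End JetAlgebra.

(** * Linear algebra of an invariant tangent space *)

Lemma bilin_mxN (R : realType) m (A : 'M[R]_m) u v : bilin (- A) u v = - bilin A u v.
Proof. by rewrite /bilin mulmxN mulNmx mxE. Qed.

Lemma ev_inj (R : realType) m (a b : 'cV[R]_m) : (forall u, ev a u = ev b u) -> a = b.
Proof.
move=> ab; apply/matrixP => i k; rewrite ord1.
by have := ab (delta_mx 0 i); rewrite /ev -!rowE !mxE.
Qed.

(** By polarisation [M] is antisymmetric. *)
Lemma mxtrace_sym_alt (R : realType) n (S M : 'M[R]_n) :
  S^T = S -> (forall u, bilin M u u = 0) -> \tr (S *m M) = 0.
Proof.
move=> Ssym M0.
have MT : M^T = - M.
  apply: bilin_inj => u v; rewrite bilin_tr.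
  have := M0 (u + v); rewrite bilinDl !bilinDr !M0 bilin_mxN; lra.
have : \tr (S *m M) = - \tr (S *m M).
  by rewrite -[LHS]mxtrace_tr trmx_mul MT Ssym mulNmx linearN /= mxtrace_mulC.
by move=> H; lra.
Qed.

Lemma mxtrace_rank1 (R : realType) n (w : 'rV[R]_n) (M : 'M[R]_n) :
  \tr (w^T *m w *m M) = bilin M w w.
Proof. by rewrite -mulmxA mxtrace_mulC /bilin /mxtrace big_ord1. Qed.

(** A symmetric idempotent matrix of size 2, with entries [p], [q] and [r], has rank
    0, 2 or 1. *)
Lemma idempotent22_trace (R : realType) (p q r : R) :
  p = p * p + q * q -> q = p * q + q * r -> r = q * q + r * r ->
  [\/ [/\ p = 0, q = 0 & r = 0], [/\ p = 1, q = 0 & r = 1] | p + r = 1].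
Proof.
move=> hp hq hr.
have [q0|q0] := eqVneq q 0; last first.
  by constructor 3; apply: (mulfI q0); lra.
have [p0|p1] : p = 0 \/ p = 1.
  have /eqP : p * (p - 1) = 0 by rewrite q0 in hp; lra.
  by rewrite mulf_eq0 subr_eq0 => /orP[]/eqP; auto.
  have [r0|r1] : r = 0 \/ r = 1.
    have /eqP : r * (r - 1) = 0 by rewrite q0 in hr; lra.
    by rewrite mulf_eq0 subr_eq0 => /orP[]/eqP; auto.
  by constructor 1.
  by constructor 3; lra.
have [r0|r1] : r = 0 \/ r = 1.
  have /eqP : r * (r - 1) = 0 by rewrite q0 in hr; lra.
  by rewrite mulf_eq0 subr_eq0 => /orP[]/eqP; auto.
by constructor 3; lra.
by constructor 2.
Qed.

(** [T] is the matrix of the differential of the parametrisation, so its row space is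
    the tangent space, and [Q] is the endomorphism that [phi] induces there. *)
Section TangentAlgebra.
Variables (R : realType) (m n : nat) (j : contact_jet R m).
Variables (T : 'M[R]_(n, m)) (Q : 'M[R]_n).
Hypotheses (T_free : row_free T) (T_inv : T *m jP j = Q *m T).
Implicit Types u v w : 'rV[R]_n.
Local Notation g := (bilin (jG j)).
Local Notation P := (jP j).
Local Notation al1 := (ev (ja1 j)).
Local Notation al2 := (ev (ja2 j)).

Lemma jG_tr : (jG j)^T = jG j.
Proof. by apply: bilin_inj => u v; rewrite bilin_tr jG_sym. Qed.

Lemma jP_skew_mx : P *m jG j = - (jG j *m P^T).
Proof.
apply: bilin_inj => u v.
by rewrite bilin_mull jP_skew -bilin_multr bilin_mxN.
Qed.

Lemma jPa : P *m ja1 j = 0 /\ P *m ja2 j = 0.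
Proof.
by split; apply: ev_inj => u; have [h1 h2] := ja_P j u; rewrite [RHS]/ev mulmx0 [RHS]mxE /ev mulmxA.
Qed.

Lemma jGZ : jG j *m (jZ1 j)^T = ja1 j /\ jG j *m (jZ2 j)^T = ja2 j.
Proof.
split; apply: ev_inj => u; have [h1 h2] := jG_reeb j u; rewrite /ev mulmxA.
  exact: h1.
exact: h2.
Qed.

Lemma jPP_mx : P *m P = - 1%:M + ja1 j *m jZ1 j + ja2 j *m jZ2 j.
Proof.
apply/row_matrixP => i; rewrite !rowE.
have := jP_sqr j (delta_mx 0 i); rewrite -mulmxA => ->.
by rewrite !mulmxDr mulmxN mulmx1 !mulmxA !(row_mul11 (_ *m _)).
Qed.

Definition ind_metric : 'M[R]_n := T *m jG j *m T^T.
Local Notation gi := ind_metric.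
(** The pullbacks of the contact forms to the submanifold. *)
Definition pull1 : 'cV[R]_n := T *m ja1 j.
Definition pull2 : 'cV[R]_n := T *m ja2 j.

Lemma bilin_ind u v : bilin gi u v = g (u *m T) (v *m T).
Proof. by rewrite /bilin /ind_metric trmx_mul !mulmxA. Qed.

Lemma T_inj u : u *m T = 0 -> u = 0.
Proof. by move=> uT; apply: (row_free_inj T_free); rewrite uT mul0mx. Qed.

Lemma ind_unit : gi \in unitmx.
Proof.
rewrite -row_free_unit; apply: inj_row_free => u ug.
apply: T_inj; apply/eqP; apply/negP => /negP/(jG_pos j).
by rewrite -bilin_ind /bilin ug mul0mx mxE ltxx.
Qed.

Lemma ind_tr : gi^T = gi.
Proof. by rewrite /ind_metric !trmx_mul trmxK jG_tr mulmxA. Qed.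

Lemma ind_inv_tr : (invmx gi)^T = invmx gi.
Proof. by rewrite trmx_inv ind_tr. Qed.

(** [phi] is skew with respect to the metric, hence so is its restriction. *)
Lemma Q_skew : Q *m gi = - (gi *m Q^T).
Proof.
rewrite /ind_metric !mulmxA -T_inv -(mulmxA T) jP_skew_mx mulmxN mulNmx; congr (- _).
by rewrite -!mulmxA -trmx_mul T_inv trmx_mul.
Qed.

Lemma invQ : invmx gi *m Q = - (Q^T *m invmx gi).
Proof.
have u := ind_unit.
apply: (can_inj (mulmxK u)); rewrite mulNmx mulmxKV // -mulmxA Q_skew mulmxN.
by rewrite mulKmx.
Qed.

(** The coordinates of the orthogonal projections of the Reeb vectors onto the tangent
    space. *)
Definition reeb_tan1 : 'rV[R]_n := pull1^T *m invmx gi.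
Definition reeb_tan2 : 'rV[R]_n := pull2^T *m invmx gi.

Lemma Q_sqr : Q *m Q = - 1%:M + pull1 *m reeb_tan1 + pull2 *m reeb_tan2.
Proof.
have u := ind_unit; have [z1 z2] := jGZ.
apply: (can_inj (mulmxK u)).
have E : Q *m Q *m gi = T *m (P *m P) *m jG j *m T^T.
  by rewrite /ind_metric !mulmxA -[Q *m Q *m T]mulmxA -T_inv mulmxA -T_inv.
have t1 : jZ1 j *m (jG j *m T^T) = pull1^T.
  by rewrite /pull1 -z1 !trmx_mul trmxK jG_tr mulmxA.
have t2 : jZ2 j *m (jG j *m T^T) = pull2^T.
  by rewrite /pull2 -z2 !trmx_mul trmxK jG_tr mulmxA.
rewrite E jPP_mx !mulmxDl mulNmx mul1mx /reeb_tan1 /reeb_tan2 -!mulmxA !mulVmx // !mulmx1.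
rewrite !mulmxDl mulNmx mul1mx !mulmxDr mulmxN.
by rewrite -(mulmxA (ja1 j)) t1 -(mulmxA (ja2 j)) t2 /ind_metric !mulmxA.
Qed.

Lemma Q_pull : Q *m pull1 = 0 /\ Q *m pull2 = 0.
Proof.
have [p1 p2] := jPa.
by rewrite /pull1 /pull2 !mulmxA -T_inv -!mulmxA p1 p2 !mulmx0.
Qed.

(** For tangent [X] one has [g(phi z, X) = - g(z, phi X) = - g(Z, phi X) = 0] if [z] is
    the tangential part of the Reeb vector [Z], since [phi X] is tangent.  So
    [phi z = 0], and the projection onto the tangent space preserves the Reeb
    plane. *)
Lemma reeb_tan_Q : reeb_tan1 *m Q = 0 /\ reeb_tan2 *m Q = 0.
Proof.
have [q1 q2] := Q_pull.
rewrite /reeb_tan1 /reeb_tan2 -!mulmxA invQ !mulmxN !mulmxA -!trmx_mul.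
by rewrite q1 q2 !trmx0 !mul0mx oppr0.
Qed.

(** Dually: [Q] is an isometry away from the tangential Reeb directions. *)
Lemma QinvQ :
  Q^T *m invmx gi *m Q = invmx gi - reeb_tan1^T *m reeb_tan1 - reeb_tan2^T *m reeb_tan2.
Proof.
rewrite -[Q^T *m _]opprK -invQ mulNmx -mulmxA Q_sqr !mulmxDr mulmxN mulmx1 !opprD opprK.
by rewrite /reeb_tan1 /reeb_tan2 !trmx_mul !trmxK ind_inv_tr !mulmxA.
Qed.

Lemma kerQ_reeb w : w *m Q = 0 -> w *m T = al1 (w *m T) *: jZ1 j + al2 (w *m T) *: jZ2 j.
Proof. by move=> wQ; apply: reeb_of_kerP; rewrite -mulmxA T_inv mulmxA wQ mul0mx. Qed.

(** The entries of the symmetric matrix of the orthogonal projection onto the tangent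
    space, restricted to the Reeb plane. *)
Definition reeb_proj11 := ev pull1 reeb_tan1.
Definition reeb_proj12 := ev pull2 reeb_tan1.
Definition reeb_proj22 := ev pull2 reeb_tan2.

Lemma pull_ev u : ev pull1 u = al1 (u *m T) /\ ev pull2 u = al2 (u *m T).
Proof. by rewrite /ev /pull1 /pull2 !mulmxA. Qed.

Lemma reeb_proj21 : ev pull1 reeb_tan2 = reeb_proj12.
Proof.
rewrite /reeb_proj12 /reeb_tan1 /reeb_tan2 /ev.
have -> : pull1^T *m invmx gi *m pull2 = (pull2^T *m invmx gi *m pull1)^T.
  by rewrite [RHS]trmx_mul (trmx_mul pull2^T) trmxK ind_inv_tr mulmxA.
by rewrite [RHS]mxE.
Qed.

(** The projections of the Reeb vectors lie in the Reeb plane, where their coordinates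
    are the entries of the projection matrix. *)
Lemma reeb_tan_decomp :
  reeb_tan1 = reeb_proj11 *: reeb_tan1 + reeb_proj12 *: reeb_tan2 /\
  reeb_tan2 = reeb_proj12 *: reeb_tan1 + reeb_proj22 *: reeb_tan2.
Proof.
have H w : w *m Q = 0 -> w = ev pull1 w *: reeb_tan1 + ev pull2 w *: reeb_tan2.
  move=> wQ; have := congr1 (mulmx w) Q_sqr.
  rewrite mulmxA wQ mul0mx !mulmxDr mulmxN mulmx1 => /esym/eqP.
  rewrite -addrA addrC subr_eq0 => /eqP E.
  by rewrite -{1}E (mulmxA w pull1) (mulmxA w pull2) !row_mul11.
have [h1 h2] := reeb_tan_Q.
by split; rewrite {1}(H _ h1, H _ h2) ?reeb_proj21.
Qed.

(** [alpha_i(X) = g(X, Z_i)] is unchanged if [Z_i] is projected onto the tangent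
    space. *)
Lemma pull_decomp u : ev pull1 u = ev pull1 u * reeb_proj11 + ev pull2 u * reeb_proj12 /\
  ev pull2 u = ev pull1 u * reeb_proj12 + ev pull2 u * reeb_proj22.
Proof.
have [q1 q2] := Q_pull.
have H (a : 'cV[R]_n) : Q *m a = 0 ->
    ev a u = ev pull1 u * ev a reeb_tan1 + ev pull2 u * ev a reeb_tan2.
  move=> qa; have E : a = pull1 *m (reeb_tan1 *m a) + pull2 *m (reeb_tan2 *m a).
    have := congr1 (mulmx^~ a) Q_sqr.
    rewrite /= -mulmxA qa mulmx0 !mulmxDl mulNmx mul1mx => /esym/eqP.
    by rewrite -addrA addrC subr_eq0 -!(mulmxA _ _ a) => /eqP->.
  rewrite {1}E {1}/ev mulmxDr (mulmxA u pull1) (mulmxA u pull2) mxE.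
  by rewrite [X in X + _]mxE [X in _ + X]mxE !big_ord1.
by split; rewrite {1}(H _ q1, H _ q2) // reeb_proj21.
Qed.

Section Trace.
Variables (Bm : 'M[R]_n).
Hypothesis Bm_line : forall u,
  bilin Bm (u *m Q) (u *m Q) + bilin Bm (u *m Q *m Q) (u *m Q *m Q) = 0.
Hypothesis Bm_reeb : forall w c1 c2, w *m T = c1 *: jZ1 j + c2 *: jZ2 j ->
  bilin Bm w w = 0.

(** Conjugating a form by the partial isometry [Q] alters its trace by the values on
    the Reeb directions only. *)
Lemma trace_conjQ (M : 'M[R]_n) :
  \tr (invmx gi *m (Q *m M *m Q^T)) =
  \tr (invmx gi *m M) - bilin M reeb_tan1 reeb_tan1 - bilin M reeb_tan2 reeb_tan2.
Proof.
rewrite mulmxA mxtrace_mulC !mulmxA QinvQ !mulmxBl !linearB /=.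
by rewrite !mxtrace_rank1.
Qed.

(** The conjugates of [Bm] by [Q] and by the square of [Q] both have the trace of [Bm],
    and their sum is the form [Bm(Q u, Q u) + Bm(Q Q u, Q Q u)]. *)
Lemma trace_zero : \tr (invmx gi *m Bm) = 0.
Proof.
have [q1 q2] := reeb_tan_Q.
have b1 : bilin Bm reeb_tan1 reeb_tan1 = 0 by apply: Bm_reeb (kerQ_reeb q1).
have b2 : bilin Bm reeb_tan2 reeb_tan2 = 0 by apply: Bm_reeb (kerQ_reeb q2).
pose B1 := Q *m Bm *m Q^T.
have b3 w : w *m Q = 0 -> bilin B1 w w = 0.
  by move=> wQ; rewrite bilin_multr bilin_mull wQ bilin0l.
have E1 : \tr (invmx gi *m B1) = \tr (invmx gi *m Bm).
  by rewrite trace_conjQ b1 b2 !subr0.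
have E2 : \tr (invmx gi *m (Q *m B1 *m Q^T)) = \tr (invmx gi *m Bm).
  by rewrite trace_conjQ !b3 // !subr0.
have : \tr (invmx gi *m (B1 + Q *m B1 *m Q^T)) = 0.
  apply: mxtrace_sym_alt; first exact: ind_inv_tr.
  move=> u; rewrite bilin_mxD /B1 !(bilin_multr, bilin_mull).
  exact: Bm_line.
rewrite mulmxDr linearD /= E1 E2 => H; lra.
Qed.
End Trace.

Lemma reeb_proj_idem : [/\ reeb_proj11 = reeb_proj11 * reeb_proj11 + reeb_proj12 * reeb_proj12,
  reeb_proj12 = reeb_proj11 * reeb_proj12 + reeb_proj12 * reeb_proj22
  & reeb_proj22 = reeb_proj12 * reeb_proj12 + reeb_proj22 * reeb_proj22].
Proof.
have [h1 h2] := reeb_tan_decomp.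
split; rewrite -/reeb_proj11.
- by rewrite {1}/reeb_proj11 h1 evD !evZ reeb_proj21.
- by rewrite {1}/reeb_proj12 h1 evD !evZ.
- by rewrite {1}/reeb_proj22 h2 evD !evZ.
Qed.

Lemma reeb_tan_reeb : reeb_tan1 *m T = reeb_proj11 *: jZ1 j + reeb_proj12 *: jZ2 j /\
  reeb_tan2 *m T = reeb_proj12 *: jZ1 j + reeb_proj22 *: jZ2 j.
Proof.
have [q1 q2] := reeb_tan_Q.
have [e11 e12] := pull_ev reeb_tan1; have [e21 e22] := pull_ev reeb_tan2.
by rewrite {1}(kerQ_reeb q1) {1}(kerQ_reeb q2) -e11 -e12 -e21 -e22 reeb_proj21.
Qed.

(** If [phi] vanishes on the tangent space, the latter lies in the Reeb plane. *)
Lemma Q_eq0_trace : Q = 0 -> reeb_proj11 + reeb_proj22 = n%:R.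
Proof.
move=> Q0; have := congr1 (@mxtrace R n) Q_sqr.
rewrite Q0 mulmx0 mxtrace0 !linearD linearN /= mxtrace1 (mxtrace_mulC pull1) (mxtrace_mulC pull2).
rewrite /mxtrace !big_ord1 -/(ev pull1 reeb_tan1) -/(ev pull2 reeb_tan2).
by rewrite -/reeb_proj11 -/reeb_proj22 => H; lra.
Qed.

(** The projection matrix has determinant 0 when its trace is 1, and the pulled back
    pair of forms factors through it. *)
Lemma minor_zero : reeb_proj11 + reeb_proj22 = 1 ->
  forall u v, ev pull1 u * ev pull2 v = ev pull1 v * ev pull2 u.
Proof.
move=> tr1 u v; have [i1 i2 i3] := reeb_proj_idem.
have dt : reeb_proj11 * reeb_proj22 = reeb_proj12 * reeb_proj12.
  have -> : reeb_proj22 = 1 - reeb_proj11 by lra.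
  rewrite mulrBr mulr1; lra.
have [u1 u2] := pull_decomp u; have [v1 v2] := pull_decomp v.
apply/eqP; rewrite -subr_eq0; apply/eqP.
have -> : ev pull1 u * ev pull2 v - ev pull1 v * ev pull2 u =
  (ev pull1 u * ev pull2 v - ev pull1 v * ev pull2 u) *
  (reeb_proj11 * reeb_proj22 - reeb_proj12 * reeb_proj12).
  transitivity ((ev pull1 u * reeb_proj11 + ev pull2 u * reeb_proj12) *
      (ev pull1 v * reeb_proj12 + ev pull2 v * reeb_proj22) -
    (ev pull1 v * reeb_proj11 + ev pull2 v * reeb_proj12) *
      (ev pull1 u * reeb_proj12 + ev pull2 u * reeb_proj22)).
    by rewrite -u1 -u2 -v1 -v2.
  ring.
by rewrite dt subrr mulr0.
Qed.

Lemma reeb_witness : reeb_proj11 + reeb_proj22 = 1 ->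
  exists w c1 c2, w *m T = c1 *: jZ1 j + c2 *: jZ2 j /\ (c1 != 0) || (c2 != 0).
Proof.
move=> tr1; have [h1 h2] := reeb_tan_reeb.
have [p0|p0] := eqVneq reeb_proj11 0; last first.
  by exists reeb_tan1, reeb_proj11, reeb_proj12; rewrite p0.
exists reeb_tan2, reeb_proj12, reeb_proj22; split=> //; apply/orP; right.
have -> : reeb_proj22 = 1 by lra.
exact: oner_neq0.
Qed.

(** [g(phi X, phi X) = Om(phi X, X)] for tangent [X], and [phi X] is tangent. *)
Lemma Q_eq0_of_W0 :
  (forall p q, bilin (jW1 j) (p *m T) (q *m T) + bilin (jW2 j) (p *m T) (q *m T) = 0) ->
  Q = 0.
Proof.
move=> W0; apply/row_matrixP => i; rewrite row0 rowE; set q := delta_mx _ _.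
apply: T_inj; apply/eqP/negP => /negP/(jG_pos j).
have -> : q *m Q *m T = q *m T *m P by rewrite -mulmxA -T_inv mulmxA.
rewrite jG_assoc -mulmxA T_inv mulmxA.
by rewrite W0 ltxx.
Qed.

Definition normal_vec (nu : 'rV[R]_m) := forall u, g (u *m T) nu = 0.

Lemma normal_vecP nu : normal_vec nu -> normal_vec (nu *m P).
Proof.
move=> nn u; apply/eqP; rewrite -oppr_eq0 -jP_skew -mulmxA T_inv mulmxA.
by rewrite nn.
Qed.

Lemma normal_reeb nu w c1 c2 : normal_vec nu -> w *m T = c1 *: jZ1 j + c2 *: jZ2 j ->
  c1 * al1 nu + c2 * al2 nu = 0.
Proof. by move=> nn wT; rewrite -g_reeb_comb -wT jG_sym nn. Qed.

(** [H w u] stands for the second derivative of the parametrisation in the coordinate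
    directions [w] and [u]. *)
Section SecondOrder.
Variable H : 'rV[R]_n -> 'rV[R]_n -> 'rV[R]_m.
Hypothesis H_lin : forall c u v w, H (c *: u + v) w = c *: H u w + H v w.
Hypothesis H_sym : forall u v, H u v = H v u.

(** The derivative in the direction [w] of the pulled back contact forms evaluated on
    the constant coordinate vector [u], and below the same for their exterior
    derivatives; the chain rule gives these formulas. *)
Definition pull1_deriv w u : R := al1 (H w u) + ev (jda1 j (w *m T)) (u *m T).
Definition pull2_deriv w u : R := al2 (H w u) + ev (jda2 j (w *m T)) (u *m T).
Definition pullW1_deriv w p q : R := bilin (jW1 j) (H w p) (q *m T) +
  bilin (jW1 j) (p *m T) (H w q) + bilin (jdW1 j (w *m T)) (p *m T) (q *m T).
Definition pullW2_deriv w p q : R := bilin (jW2 j) (H w p) (q *m T) +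
  bilin (jW2 j) (p *m T) (H w q) + bilin (jdW2 j (w *m T)) (p *m T) (q *m T).

(** What the two lemmas on jets leave over vanishes, in the directions that enter the
    trace. *)
Definition alpha_normal : Prop := forall nu w, normal_vec nu ->
  (al1 (w *m T) = 0 /\ al2 (w *m T) = 0) \/
  (exists c1 c2, w *m T = c1 *: jZ1 j + c2 *: jZ2 j) ->
  al1 nu * pull1_deriv w w + al2 nu * pull2_deriv w w = 0.

(** Pullback commutes with the exterior derivative. *)
Lemma pull_deriv_skew w u :
  pull1_deriv w u - pull1_deriv u w = 2 * bilin (jW1 j) (w *m T) (u *m T) /\
  pull2_deriv w u - pull2_deriv u w = 2 * bilin (jW2 j) (w *m T) (u *m T).
Proof.
have [-> ->] := jWE j (w *m T) (u *m T).
by rewrite /pull1_deriv /pull2_deriv (H_sym u w); split; lra.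
Qed.

(** The pullback of a closed 2-form is closed. *)
Lemma pullW_deriv_cyclic w p q :
  pullW1_deriv w p q + pullW1_deriv p q w + pullW1_deriv q w p = 0 /\
  pullW2_deriv w p q + pullW2_deriv p q w + pullW2_deriv q w p = 0.
Proof.
rewrite /pullW1_deriv /pullW2_deriv (H_sym p w) (H_sym q p) (H_sym q w).
have [c1 c2] := jdW_closed j (p *m T) (q *m T) (w *m T).
have [s1 s2] := jW_skew j (H w p) (q *m T).
have [s3 s4] := jW_skew j (H w q) (p *m T).
have [s5 s6] := jW_skew j (H p q) (w *m T).
split; lra.
Qed.

Lemma alpha_normal_full : reeb_proj11 = 1 -> reeb_proj12 = 0 -> reeb_proj22 = 1 -> alpha_normal.
Proof.
move=> e1 e2 e3 nu w nn _; have [h1 h2] := reeb_tan_reeb.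
have n1 := normal_reeb nn h1; have n2 := normal_reeb nn h2.
rewrite e1 e2 e3 in n1 n2.
have -> : al1 nu = 0 by lra.
have -> : al2 nu = 0 by lra.
by rewrite !mul0r addr0.
Qed.

Lemma alpha_zero_absurd : reeb_proj11 = 0 -> reeb_proj22 = 0 -> (0 < n)%N ->
  (forall w u, pull1_deriv w u = 0 /\ pull2_deriv w u = 0) -> False.
Proof.
move=> e1 e2 n0 d0.
have /Q_eq0_trace : Q = 0.
  apply: Q_eq0_of_W0 => p q; have [s1 s2] := pull_deriv_skew p q.
  have [x1 x2] := d0 p q; have [x3 x4] := d0 q p; lra.
rewrite e1 e2 addr0 => /esym/eqP; rewrite pnatr_eq0 => /eqP n00.
by rewrite n00 in n0.
Qed.

(** The tangent space meets the Reeb plane in a line.  The two hypotheses on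
    derivatives express that [alpha1 /\ alpha2], and then the combination
    [alpha2(u) d alpha1 - alpha1(u) d alpha2], vanish along the submanifold in a
    neighbourhood of the point. *)
Section RankOne.
Hypothesis tr1 : reeb_proj11 + reeb_proj22 = 1.
Hypothesis minor_deriv : forall w u v,
  pull1_deriv w u * ev pull2 v + ev pull1 u * pull2_deriv w v =
  pull1_deriv w v * ev pull2 u + ev pull1 v * pull2_deriv w u.

(** Antisymmetrising the derivative of the minor gives
    [d alpha1 /\ alpha2 = alpha1 /\ d alpha2] on the submanifold; contract with the
    tangential Reeb vector, on which both exterior derivatives vanish. *)
Lemma W_proportional_reeb w0 c1 c2 p q : w0 *m T = c1 *: jZ1 j + c2 *: jZ2 j ->
  c2 * bilin (jW1 j) (p *m T) (q *m T) = c1 * bilin (jW2 j) (p *m T) (q *m T).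
Proof.
move=> w0T.
have [e1 e2] := pull_ev w0; rewrite w0T in e1 e2.
have [a1 a2] := al_reeb_comb j c1 c2; rewrite a1 in e1; rewrite a2 in e2.
have m1 := minor_deriv p q w0; have m2 := minor_deriv q w0 p; have m3 := minor_deriv w0 p q.
have [s1 s2] := pull_deriv_skew p q.
have [s3 s4] := pull_deriv_skew q w0.
have [s5 s6] := pull_deriv_skew w0 p.
have [r1 r2] := jW_reeb_comb j c1 c2 (p *m T).
have [r3 r4] := jW_reeb_comb j c1 c2 (q *m T).
have [k1 k2] := jW_skew j (w0 *m T) (q *m T).
rewrite w0T in s3 s4 s5 s6 k1 k2.
rewrite e1 e2 in m1 m2 m3.
have E1 : pull1_deriv w0 p = pull1_deriv p w0 by lra.
have E2 : pull2_deriv w0 p = pull2_deriv p w0 by lra.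
have E3 : pull1_deriv w0 q = pull1_deriv q w0 by lra.
have E4 : pull2_deriv w0 q = pull2_deriv q w0 by lra.
rewrite E1 E2 E3 E4 in m3.
have S1 : bilin (jW1 j) (p *m T) (q *m T) = 2^-1 * (pull1_deriv p q - pull1_deriv q p) by lra.
have S2 : bilin (jW2 j) (p *m T) (q *m T) = 2^-1 * (pull2_deriv p q - pull2_deriv q p) by lra.
rewrite S1 S2; lra.
Qed.

(** Two plane vectors that are both proportional to a nonzero one are proportional to
    each other. *)
Lemma cross_zero (x y a b c d : R) : (c != 0) || (d != 0) -> d * x = c * y ->
  d * a = c * b -> a * y = b * x.
Proof.
move=> cd xy ab; apply/eqP; rewrite -subr_eq0.
have h1 : c * (a * y - b * x) = 0.
  by rewrite mulrBr mulrCA -xy mulrCA [b * x]mulrC [c * _]mulrCA -ab; ring.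
have h2 : d * (a * y - b * x) = 0.
  by rewrite mulrBr mulrA ab mulrCA xy; ring.
case/orP: cd => h; [move/eqP: h1|move/eqP: h2]; by rewrite mulf_eq0 (negPf h).
Qed.

Lemma W_proportional u p q :
  ev pull2 u * bilin (jW1 j) (p *m T) (q *m T) = ev pull1 u * bilin (jW2 j) (p *m T) (q *m T).
Proof.
have [w0 [c1 [c2 [w0T c0]]]] := reeb_witness tr1.
have [e1 e2] := pull_ev w0; rewrite w0T in e1 e2.
have [a1 a2] := al_reeb_comb j c1 c2; rewrite a1 in e1; rewrite a2 in e2.
have h := W_proportional_reeb p q w0T.
have mn := minor_zero tr1 u w0; rewrite e1 e2 in mn.
by apply/esym/(cross_zero c0 h); lra.
Qed.

Hypothesis n1 : (1 < n)%N.
Hypothesis proportional_deriv : forall w u p q,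
  pull2_deriv w u * bilin (jW1 j) (p *m T) (q *m T) + ev pull2 u * pullW1_deriv w p q =
  pull1_deriv w u * bilin (jW2 j) (p *m T) (q *m T) + ev pull1 u * pullW2_deriv w p q.

(** A normal vector is orthogonal to the tangential Reeb vector [c1 Z1 + c2 Z2], so it
    suffices that the derivatives of [alpha1] and [alpha2] be in the ratio of [c1] to
    [c2].  For [w] in the kernel of both forms this is the derivative of the minor.
    For [w] in the Reeb direction, take the cyclic sum of [proportional_deriv]:
    closedness removes the derivatives of [d alpha1] and [d alpha2], and what is left
    compares the ratio of the derivatives with the ratio of [d alpha1] and
    [d alpha2] themselves. *)
Lemma alpha_normal_rank1 : alpha_normal.
Proof.
move=> nu w nn.
have fin w0 c1 c2 : w0 *m T = c1 *: jZ1 j + c2 *: jZ2 j -> (c1 != 0) || (c2 != 0) ->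
   c2 * pull1_deriv w w = c1 * pull2_deriv w w ->
   al1 nu * pull1_deriv w w + al2 nu * pull2_deriv w w = 0.
  move=> w0T c0 E; have nr := normal_reeb nn w0T.
  have := @cross_zero (pull1_deriv w w) (pull2_deriv w w) (al2 nu) (- al1 nu) c1 c2 c0 E.
  move=> H0; have := H0 _; lra.
move=> [[w1 w2]|[c1 [c2 wT]]].
  have [w0 [c1 [c2 [w0T c0]]]] := reeb_witness tr1.
  apply: (fin _ _ _ w0T c0).
  have [e1 e2] := pull_ev w0; rewrite w0T in e1 e2.
  have [a1 a2] := al_reeb_comb j c1 c2; rewrite a1 in e1; rewrite a2 in e2.
  have := minor_deriv w w w0; have [-> ->] := pull_ev w; rewrite w1 w2 e1 e2; lra.
have [c0|] := boolP ((c1 != 0) || (c2 != 0)); last first.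
  rewrite negb_or !negbK => /andP[/eqP c10 /eqP c20].
  have w0 : w = 0 by apply: T_inj; rewrite wT c10 c20 !scale0r addr0.
  have H0 : H 0 0 = 0.
    by have := H_lin (-1) 0 0 0; rewrite scaler0 addr0 scaleN1r => {1}->; rewrite addNr.
  by rewrite w0 /pull1_deriv /pull2_deriv H0 mul0mx !ev0 !addr0 !mulr0 addr0.
apply: (fin _ _ _ wT c0).
have B0 p q : pull2_deriv w w * bilin (jW1 j) (p *m T) (q *m T) =
    pull1_deriv w w * bilin (jW2 j) (p *m T) (q *m T).
  have [r1 r2] := jW_reeb_comb j c1 c2 (p *m T).
  have [r3 r4] := jW_reeb_comb j c1 c2 (q *m T).
  have [k1 k2] := jW_skew j (w *m T) (q *m T).
  have d1 := proportional_deriv w w p q; have d2 := proportional_deriv p w q w.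
  have d3 := proportional_deriv q w w p.
  have [y1 y2] := pullW_deriv_cyclic w p q.
  rewrite -wT in r1 r2 r3 r4.
  rewrite r3 in k1; rewrite r4 in k2.
  have k1' : bilin (jW1 j) (q *m T) (w *m T) = 0 by lra.
  have k2' : bilin (jW2 j) (q *m T) (w *m T) = 0 by lra.
  rewrite k1' k2' in d2; rewrite r1 r2 in d3.
  have z1 : pullW1_deriv w p q = - pullW1_deriv p q w - pullW1_deriv q w p by lra.
  have z2 : pullW2_deriv w p q = - pullW2_deriv p q w - pullW2_deriv q w p by lra.
  rewrite z1 z2 in d1; lra.
(* Otherwise phi kills the tangent space, which then lies in the Reeb plane and has
   dimension 1. *)
have [p [q pq]] : exists p q,
    bilin (jW1 j) (p *m T) (q *m T) + bilin (jW2 j) (p *m T) (q *m T) != 0.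
  apply: contrapT => nex.
  have /Q_eq0_trace : Q = 0.
    apply: Q_eq0_of_W0 => p q; apply/eqP/negPn/negP => pq.
    by apply: nex; exists p, q.
  rewrite tr1 => /esym/eqP; rewrite pnatr_eq1 => /eqP n11.
  by move: n1; rewrite n11.
have h1 := B0 p q; have h2 := W_proportional_reeb p q wT.
set x := bilin (jW1 j) _ _ in pq h1 h2; set y := bilin (jW2 j) _ _ in pq h1 h2.
apply: (mulIf pq).
have f1 : c2 * pull1_deriv w w * x = c1 * pull2_deriv w w * x.
  by rewrite mulrAC h2 -!mulrA; congr (c1 * _); rewrite mulrC h1.
have f2 : c2 * pull1_deriv w w * y = c1 * pull2_deriv w w * y.
  by rewrite -mulrA -h1 mulrCA h2; ring.
by rewrite [LHS]mulrDr [RHS]mulrDr f1 f2.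
Qed.

End RankOne.

Section TraceSecondOrder.
Variable nu : 'rV[R]_m.
Hypothesis nu_normal : normal_vec nu.
Hypothesis inv_deriv : forall mu u v, normal_vec mu ->
  - g (H v u) (mu *m P) + g (u *m T *m jdP j (v *m T)) mu = g (H v (u *m Q)) mu.
Hypothesis al_normal : alpha_normal.

(** The second fundamental form along [nu]: the normal projection is implicit in
    pairing with a normal vector. *)
Definition sff u v : R := g (H u v) nu + jgamma j (u *m T) (v *m T) nu.

Lemma sff_sym u v : sff u v = sff v u.
Proof. by rewrite /sff H_sym jgamma_sym. Qed.

Lemma sff_lin c u v w : sff (c *: u + v) w = c * sff u w + sff v w.
Proof.
rewrite /sff H_lin bilinDl bilinZl mulmxDl -scalemxAl jgammaDl jgammaZl; ring.
Qed.

Definition sff_mx : 'M[R]_n := \matrix_(a, b) sff (delta_mx 0 a) (delta_mx 0 b).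

Lemma bilin_sff u v : bilin sff_mx u v = sff u v.
Proof.
have sffD a b w : sff (a + b) w = sff a w + sff b w.
  by have := sff_lin 1 a b w; rewrite scale1r mul1r.
have sff0 w : sff 0 w = 0 by have := sffD 0 0 w; rewrite addr0; lra.
have sffZ c a w : sff (c *: a) w = c * sff a w.
  by have := sff_lin c a 0 w; rewrite addr0 sff0 addr0.
have S (s : 'rV[R]_n) w : sff s w = \sum_a s 0 a * sff (delta_mx 0 a) w.
  exact: (row_expand _ (fun a b => sffD a b w) (fun c a => sffZ c a w)).
rewrite S /bilin mxE.
under eq_bigr => k _ do rewrite mxE mulr_suml.
rewrite exchange_big /=; apply: eq_bigr => a _.
rewrite sff_sym S mulr_sumr; apply: eq_bigr => b _.
by rewrite !mxE sff_sym; ring.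
Qed.

Lemma sff_trace : \sum_a \sum_b invmx gi a b * sff (delta_mx 0 a) (delta_mx 0 b) = 0.
Proof.
suff : \tr (invmx gi *m sff_mx) = 0.
  move=> tr0; rewrite -[RHS]tr0 /mxtrace; apply: eq_bigr => a _; rewrite [RHS]mxE.
  by apply: eq_bigr => b _; rewrite !mxE sff_sym.
apply: trace_zero => [u|w c1 c2 wT]; rewrite !bilin_sff.
  have uQT : u *m Q *m T = u *m T *m P by rewrite -mulmxA -T_inv mulmxA.
  have [x1 x2] := ja_P j (u *m T); rewrite -uQT in x1 x2.
  have QQT : u *m Q *m Q *m T = u *m Q *m T *m P by rewrite -mulmxA -T_inv mulmxA.
  rewrite /sff QQT.
  apply: (jet_complex_line (h12 := H (u *m Q) (u *m Q *m Q))) => //.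
  - by rewrite -QQT H_sym inv_deriv.
  - by rewrite (inv_deriv _ _ (normal_vecP nu_normal)).
  - by apply: al_normal => //; left.
rewrite /sff wT.
apply: jet_reeb_line; rewrite -wT.
  rewrite (inv_deriv _ _ (normal_vecP nu_normal)).
  have -> : w *m Q = 0 by apply: T_inj; rewrite -mulmxA -T_inv mulmxA wT P_reeb_comb.
  have H0 : H 0 w = 0.
    by have := H_lin (-1) 0 0 w; rewrite scaler0 addr0 scaleN1r => {1}->; rewrite addNr.
  by rewrite H_sym H0 bilin0l.
by apply: al_normal => //; right; exists c1, c2.
Qed.

End TraceSecondOrder.
End SecondOrder.

End TangentAlgebra.

(** * The jets of a metric contact structure in a chart *)

Lemma derive_eq_on (R : realType) (V W : normedModType R) (E : set V) (A B : V -> W) (x w : V) :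
  open E -> E x -> (forall y, E y -> A y = B y) -> 'D_w A x = 'D_w B x.
Proof. by move=> oE Ex AB; apply: near_eq_derive; exact: (near_open oE Ex). Qed.

(** What the components of a metric contact pair satisfy on the image of a chart. *)
Record contact_chart (R : realType) (m : nat) (E : set 'rV[R]_m)
    (G P : 'rV[R]_m -> 'M[R]_m) (a1 a2 : 'rV[R]_m -> 'cV[R]_m)
    (Z1 Z2 : 'rV[R]_m -> 'rV[R]_m) : Prop := ContactChart {
  cc_open : open E ;
  cc_smoothG : smooth_on E G ;
  cc_smoothP : smooth_on E P ;
  cc_smooth1 : smooth_on E a1 ;
  cc_smooth2 : smooth_on E a2 ;
  cc_sym : forall x, E x -> (G x)^T = G x ;
  cc_pos : forall x, E x -> forall v, v != 0 -> 0 < bilin (G x) v v ;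
  cc_reeb : forall x, E x -> [/\ ev (a1 x) (Z1 x) = 1, ev (a1 x) (Z2 x) = 0,
    ev (a2 x) (Z1 x) = 0 & ev (a2 x) (Z2 x) = 1] ;
  cc_reeb_d : forall x, E x -> forall v, [/\ ext_d a1 x (Z1 x) v = 0,
    ext_d a1 x (Z2 x) v = 0, ext_d a2 x (Z1 x) v = 0 & ext_d a2 x (Z2 x) v = 0] ;
  cc_sqr : forall x, E x -> P x *m P x = - 1%:M + a1 x *m Z1 x + a2 x *m Z2 x ;
  cc_PZ : forall x, E x -> Z1 x *m P x = 0 /\ Z2 x *m P x = 0 ;
  cc_assoc : forall x, E x -> forall u v, bilin (G x) u (v *m P x) =
    ext_d a1 x u v + ext_d a2 x u v ;
  cc_GZ : forall x, E x -> forall u, bilin (G x) u (Z1 x) = ev (a1 x) u /\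
    bilin (G x) u (Z2 x) = ev (a2 x) u
}.

Lemma bilin_metric_expand (R : realType) m (P W1 W2 dP dW1 dW2 : 'M[R]_m)
    (a1 a2 da1 da2 : 'cV[R]_m) (u v : 'rV[R]_m) :
  bilin (dP *m (W1 + W2) + P *m (dW1 + dW2) + (da1 *m a1^T + a1 *m da1^T) +
    (da2 *m a2^T + a2 *m da2^T)) u v =
  bilin dW1 (u *m P) v + bilin dW2 (u *m P) v +
  (bilin W1 (u *m dP) v + bilin W2 (u *m dP) v) +
  (ev da1 u * ev a1 v + ev a1 u * ev da1 v) +
  (ev da2 u * ev a2 v + ev a2 u * ev da2 v).
Proof.
by rewrite !bilin_mxD !bilin_col !bilin_mull !bilin_mxD; ring.
Qed.

Section JetOfChart.
Variables (R : realType) (m : nat) (E : set 'rV[R]_m).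
Variables (G P : 'rV[R]_m -> 'M[R]_m) (a1 a2 : 'rV[R]_m -> 'cV[R]_m).
Variables (Z1 Z2 : 'rV[R]_m -> 'rV[R]_m).
Hypothesis cc : contact_chart E G P a1 a2 Z1 Z2.
Local Notation W1 := (dform a1).
Local Notation W2 := (dform a2).

Section AtPoint.
Variables (x : 'rV[R]_m) (Ex : E x).
Implicit Types u v w : 'rV[R]_m.

Lemma cc_diffG : differentiable G x.
Proof. exact: smooth_on_differentiable (cc_open cc) (cc_smoothG cc) Ex. Qed.
Lemma cc_diffP : differentiable P x.
Proof. exact: smooth_on_differentiable (cc_open cc) (cc_smoothP cc) Ex. Qed.
Lemma cc_diff1 : differentiable a1 x.
Proof. exact: smooth_on_differentiable (cc_open cc) (cc_smooth1 cc) Ex. Qed.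
Lemma cc_diff2 : differentiable a2 x.
Proof. exact: smooth_on_differentiable (cc_open cc) (cc_smooth2 cc) Ex. Qed.
Lemma cc_diffW1 : differentiable W1 x.
Proof.
exact: smooth_on_differentiable (cc_open cc) (smooth_dform (cc_open cc) (cc_smooth1 cc)) Ex.
Qed.
Lemma cc_diffW2 : differentiable W2 x.
Proof.
exact: smooth_on_differentiable (cc_open cc) (smooth_dform (cc_open cc) (cc_smooth2 cc)) Ex.
Qed.

Lemma cc_W1 u v : bilin (W1 x) u v = ext_d a1 x u v.
Proof. exact: bilin_dform (cc_open cc) (cc_smooth1 cc) _ _ _ Ex. Qed.
Lemma cc_W2 u v : bilin (W2 x) u v = ext_d a2 x u v.
Proof. exact: bilin_dform (cc_open cc) (cc_smooth2 cc) _ _ _ Ex. Qed.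

Lemma cc_assoc_mx : G x *m (P x)^T = W1 x + W2 x.
Proof.
apply: bilin_inj => u v.
rewrite bilin_multr bilin_mxD; apply: (etrans (cc_assoc cc Ex u v)).
exact: (esym (congr2 +%R (cc_W1 u v) (cc_W2 u v))).
Qed.

(** The metric in terms of [phi] and of the contact forms: [phi] is an isometry on the
    orthogonal of the Reeb plane, and [Om = g(., phi .)]. *)
Lemma cc_metric_mx : G x = P x *m (W1 x + W2 x) + a1 x *m (a1 x)^T + a2 x *m (a2 x)^T.
Proof.
apply: bilin_inj => u v.
rewrite !bilin_mxD bilin_mull !bilin_col bilin_mxD cc_W1 cc_W2.
rewrite (ext_d_skew (cc_open cc) (cc_smooth1 cc) _ v Ex).
rewrite (ext_d_skew (cc_open cc) (cc_smooth2 cc) _ v Ex).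
rewrite -opprD -(cc_assoc cc) // -mulmxA (cc_sqr cc) // !mulmxDr mulmxN mulmx1.
rewrite !mulmxA !row_mul11 !bilinDr bilinNr !bilinZr -/(ev _ _) -/(ev _ _).
have [-> ->] := cc_GZ cc Ex v.
rewrite (bilin_sym v u (cc_sym cc Ex)) /ev; ring.
Qed.
End AtPoint.

Lemma dform_tr (a : 'rV[R]_m -> 'cV[R]_m) y : (dform a y)^T = - dform a y.
Proof. by apply/matrixP => i k; rewrite !mxE; ring. Qed.

Lemma derive_dform_skew (a : 'rV[R]_m -> 'cV[R]_m) x w u v : differentiable (dform a) x ->
  bilin ('D_w (dform a) x) u v = - bilin ('D_w (dform a) x) v u.
Proof.
move=> da.
have S : ('D_w (dform a) x)^T = - 'D_w (dform a) x.
  apply: (etrans (esym (derive_trmx w da))).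
  rewrite (_ : (fun y => (dform a y)^T) = - dform a); last first.
    by apply/funext => y; rewrite dform_tr.
  apply: deriveN; exact: diff_derivable.
by rewrite -[LHS]bilin_tr S bilin_mxN.
Qed.

Section Derivatives.
Variables (x : 'rV[R]_m) (Ex : E x).
Implicit Types u v w : 'rV[R]_m.

Lemma cc_dG_sym w u v : bilin ('D_w G x) u v = bilin ('D_w G x) v u.
Proof.
have dG := cc_diffG Ex.
apply: bilin_sym; apply: (etrans (esym (derive_trmx w dG))).
exact: derive_eq_on (cc_open cc) Ex (cc_sym cc).
Qed.

Lemma cc_d_assoc w u v :
  bilin ('D_w G x) u (v *m P x) + bilin (G x) u (v *m 'D_w P x) =
  bilin ('D_w W1 x) u v + bilin ('D_w W2 x) u v.
Proof.
have dG := cc_diffG Ex; have dP := cc_diffP Ex.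
have d1 := cc_diffW1 Ex; have d2 := cc_diffW2 Ex.
have := derive_eq_on w (cc_open cc) Ex cc_assoc_mx.
rewrite derive_mulmx //; last exact: differentiable_trmx.
rewrite derive_trmx // deriveD; [|exact: diff_derivable|exact: diff_derivable].
by move=> /(congr1 (fun M => bilin M u v)); rewrite !bilin_mxD !bilin_multr.
Qed.

Lemma cc_d_metric w u v : bilin ('D_w G x) u v =
    bilin ('D_w W1 x) (u *m P x) v + bilin ('D_w W2 x) (u *m P x) v +
    bilin (G x) (u *m 'D_w P x) (v *m P x) +
    (ev ('D_w a1 x) u * ev (a1 x) v + ev (a1 x) u * ev ('D_w a1 x) v) +
    (ev ('D_w a2 x) u * ev (a2 x) v + ev (a2 x) u * ev ('D_w a2 x) v).
Proof.
have dG := cc_diffG Ex; have dP := cc_diffP Ex.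
have d1 := cc_diffW1 Ex; have d2 := cc_diffW2 Ex.
have e1 := cc_diff1 Ex; have e2 := cc_diff2 Ex.
have dW : differentiable (fun y => W1 y + W2 y) x := differentiableD d1 d2.
have DW : 'D_w (fun y => W1 y + W2 y) x = 'D_w W1 x + 'D_w W2 x.
  by apply: deriveD; exact: diff_derivable.
have t1 := differentiable_trmx e1; have t2 := differentiable_trmx e2.
have p1 := differentiable_mulmx dP dW.
have p2 := differentiable_mulmx e1 t1; have p3 := differentiable_mulmx e2 t2.
have S : 'D_w (fun y => P y *m (W1 y + W2 y) + a1 y *m (a1 y)^T + a2 y *m (a2 y)^T) x =
  'D_w (fun y => P y *m (W1 y + W2 y)) x + 'D_w (fun y => a1 y *m (a1 y)^T) x +
  'D_w (fun y => a2 y *m (a2 y)^T) x.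
  rewrite deriveD; [|exact: diff_derivable (differentiableD p1 p2)|exact: diff_derivable].
  congr (_ + _); apply: deriveD; exact: diff_derivable.
have := derive_eq_on w (cc_open cc) Ex cc_metric_mx.
rewrite S !derive_mulmx // !derive_trmx // DW => /(congr1 (fun M => bilin M u v)) E1.
apply: (etrans E1); rewrite bilin_metric_expand; congr (_ + _ + _ + _).
by rewrite -bilin_mxD -(cc_assoc_mx Ex) bilin_multr.
Qed.

Lemma cc_dG_lin c s t u v : bilin ('D_(c *: s + t) G x) u v =
  c * bilin ('D_s G x) u v + bilin ('D_t G x) u v.
Proof.
by rewrite derive_linear_dir ?bilin_mxD ?bilin_mxZ //; exact: cc_diffG.
Qed.

(** Transparent, because the components are needed up to conversion. *)
Definition jet_at : contact_jet R m.
Proof.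
apply: (@ContactJet R m (G x) (P x) (a1 x) (a2 x) (Z1 x) (Z2 x) (W1 x) (W2 x)
  (fun w => 'D_w G x) (fun w => 'D_w P x) (fun w => 'D_w a1 x) (fun w => 'D_w a2 x)
  (fun w => 'D_w W1 x) (fun w => 'D_w W2 x)).
- by move=> u v; rewrite bilin_sym // (cc_sym cc).
- exact: cc_pos cc x Ex.
- exact: cc_reeb cc x Ex.
- move=> v; have [h1 h2 h3 h4] := cc_reeb_d cc Ex v; split.
  + exact: etrans (cc_W1 Ex _ _) h1.
  + exact: etrans (cc_W1 Ex _ _) h2.
  + exact: etrans (cc_W2 Ex _ _) h3.
  + exact: etrans (cc_W2 Ex _ _) h4.
- move=> u; rewrite -mulmxA (cc_sqr cc) // !mulmxDr mulmxN mulmx1.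
  by rewrite !mulmxA !row_mul11.
- exact: cc_PZ cc x Ex.
- move=> u v; apply: (etrans (cc_assoc cc Ex u v)).
  exact: (esym (congr2 +%R (cc_W1 Ex u v) (cc_W2 Ex u v))).
- exact: cc_GZ cc x Ex.
- move=> u v; split.
    exact: etrans (cc_W1 Ex u v) (ext_dE (cc_open cc) (cc_smooth1 cc) u v Ex).
  exact: etrans (cc_W2 Ex u v) (ext_dE (cc_open cc) (cc_smooth2 cc) u v Ex).
- exact: cc_dG_lin.
- exact: cc_dG_sym.
- move=> w u v; split; apply: derive_dform_skew; [exact: cc_diffW1 | exact: cc_diffW2].
- move=> u v w; split.
    exact (dform_closed (cc_open cc) (cc_smooth1 cc) u v w Ex).
  exact (dform_closed (cc_open cc) (cc_smooth2 cc) u v w Ex).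
- exact: cc_d_assoc.
- exact: cc_d_metric.
Defined.

End Derivatives.
End JetOfChart.

(** * Invariant submanifolds in a chart *)

Section AlongMap.
Variables (R : realType) (n m : nat) (D : set 'rV[R]_n) (E : set 'rV[R]_m).
Variable F : 'rV[R]_n -> 'rV[R]_m.
Hypotheses (oD : open D) (sF : smooth_on D F).

Section AtPoint.
Variables (y : 'rV[R]_n) (Dy : D y).
Implicit Types u v w : 'rV[R]_n.

Definition second_derive u v : 'rV[R]_m := 'D_u (fun z => 'D_v F z) y.

Lemma F_diff : differentiable F y.
Proof. exact: smooth_on_differentiable oD sF Dy. Qed.

Lemma DF_diff u : differentiable (fun z => 'D_u F z) y.
Proof. exact: smooth_on_differentiable oD (smooth_on_derive u oD sF) Dy. Qed.

Lemma jac_derive u : u *m jacobian F y = 'D_u F y.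
Proof. by rewrite deriveEjacobian //; exact: F_diff. Qed.

Lemma second_derive_sym u v : second_derive u v = second_derive v u.
Proof. exact: derive_comm oD sF Dy. Qed.

Lemma second_derive_lin c u v w :
  second_derive (c *: u + v) w = c *: second_derive u w + second_derive v w.
Proof. exact: derive_linear_dir (DF_diff w). Qed.

Lemma is_derive_ev_along (a : 'rV[R]_m -> 'cV[R]_m) w u : differentiable a (F y) ->
  is_derive y w (fun z => ev (a (F z)) ('D_u F z))
    (ev (a (F y)) (second_derive w u) + ev ('D_('D_w F y) a (F y)) ('D_u F y)).
Proof.
move=> da.
have daF : differentiable (fun z => a (F z)) y := differentiable_comp F_diff da.
have du := DF_diff u.
have dM := differentiable_mulmx du daF.
split; first exact: diff_derivable (differentiable_entry 0 0 dM).
apply: (etrans (esym (derive_entry w 0 0 dM))).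
rewrite (derive_mulmx w du daF) (derive_chain w F_diff da).
by rewrite mxE.
Qed.

Lemma is_derive_bilin_along (W : 'rV[R]_m -> 'M[R]_m) w p q : differentiable W (F y) ->
  is_derive y w (fun z => bilin (W (F z)) ('D_p F z) ('D_q F z))
    (bilin (W (F y)) (second_derive w p) ('D_q F y) +
     bilin (W (F y)) ('D_p F y) (second_derive w q) +
     bilin ('D_('D_w F y) W (F y)) ('D_p F y) ('D_q F y)).
Proof.
move=> dW.
have dWF : differentiable (fun z => W (F z)) y := differentiable_comp F_diff dW.
have dp := DF_diff p; have dq := DF_diff q.
have dqt := differentiable_trmx dq.
have dpW := differentiable_mulmx dp dWF.
have dM := differentiable_mulmx dpW dqt.
split; first exact: diff_derivable (differentiable_entry 0 0 dM).
apply: (etrans (esym (derive_entry w 0 0 dM))).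
rewrite (derive_mulmx w dpW dqt) (derive_mulmx w dp dWF) (derive_chain w F_diff dW).
rewrite (derive_trmx w dq) mulmxDl mxE [X in X + _]mxE.
exact: addrAC.
Qed.

End AtPoint.

Lemma smooth_jacobian : smooth_on D (fun z => jacobian F z).
Proof.
move=> i j r.
apply: (class_C_ext oD _ (smooth_on_derive (delta_mx 0 i) oD sF 0 j r)) => z Dz.
by rewrite -(jac_derive Dz) -rowE mxE.
Qed.

End AlongMap.

(** A product identity that holds on an open set may be differentiated. *)
Lemma is_derive_prod_eq (R : realType) (V : normedModType R) (f g h k : V -> R) (U : set V)
    (y w : V) (df dg dh dk : R) :
  open U -> U y -> (forall z, U z -> f z * g z = h z * k z) ->
  is_derive y w f df -> is_derive y w g dg -> is_derive y w h dh -> is_derive y w k dk ->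
  df * g y + f y * dg = dh * k y + h y * dk.
Proof.
move=> oU Uy eqU Df Dg Dh Dk.
have [_ E1] := is_deriveM Df Dg; have [_ E2] := is_deriveM Dh Dk.
have E : 'D_w (f * g) y = 'D_w (h * k) y by exact: derive_eq_on oU Uy eqU.
move: E; rewrite E1 E2 /GRing.scale /=; lra.
Qed.

Section InvariantMap.
Variables (R : realType) (n m : nat) (D : set 'rV[R]_n) (E : set 'rV[R]_m).
Variables (G P : 'rV[R]_m -> 'M[R]_m) (a1 a2 : 'rV[R]_m -> 'cV[R]_m).
Variables (Z1 Z2 : 'rV[R]_m -> 'rV[R]_m).
Hypothesis cc : contact_chart E G P a1 a2 Z1 Z2.
Variable F : 'rV[R]_n -> 'rV[R]_m.
Hypotheses (oD : open D) (sF : smooth_on D F) (DE : forall y, D y -> E (F y)).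
Hypothesis F_free : forall y, D y -> row_free (jacobian F y).
Hypothesis F_stable : forall y, D y -> stablemx (jacobian F y) (P (F y)).
Local Notation T y := (jacobian F y).

Local Notation gind := (induced_metric G F).
(** The endomorphism induced by [phi], by an explicit formula from which its continuity
    can be read. *)
Definition induced_endo y : 'M[R]_n := T y *m P (F y) *m G (F y) *m (T y)^T *m invmx (gind y).

Definition jet_along y (Dy : D y) : contact_jet R m := jet_at cc (DE Dy).

Lemma induced_metric_unit y : D y -> gind y \in unitmx.
Proof. by move=> Dy; exact: (ind_unit (jet_along Dy) (F_free Dy)). Qed.

Lemma induced_endoP y : D y -> T y *m P (F y) = induced_endo y *m T y.
Proof.
move=> Dy; have /submxP[S ES] := F_stable Dy.
rewrite {1}ES; congr (_ *m _).
by rewrite /induced_endo ES -(mulmxA S) -(mulmxA S) (mulmxK (induced_metric_unit Dy)).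
Qed.

(** The trace of the projection of the Reeb plane onto the tangent space, defined
    outside [D] as well so that one can speak of its continuity. *)
Definition reeb_trace y : R :=
  ev (T y *m a1 (F y)) ((T y *m a1 (F y))^T *m invmx (gind y)) +
  ev (T y *m a2 (F y)) ((T y *m a2 (F y))^T *m invmx (gind y)).

Lemma reeb_traceE y (Dy : D y) :
  reeb_trace y = reeb_proj11 (jet_along Dy) (T y) + reeb_proj22 (jet_along Dy) (T y).
Proof. by []. Qed.

Lemma continuous_jacobian y : D y -> {for y, continuous (fun z => T z)}.
Proof.
move=> Dy; apply: differentiable_continuous.
exact: (smooth_on_differentiable oD (smooth_jacobian oD sF)).
Qed.

Lemma continuous_along p q (A : 'rV[R]_m -> 'M[R]_(p, q)) y : D y -> smooth_on E A ->
  {for y, continuous (fun z => A (F z))}.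
Proof.
move=> Dy sA; apply: differentiable_continuous.
have dA := smooth_on_differentiable (cc_open cc) sA (DE Dy).
exact: (differentiable_comp (F_diff oD sF Dy) dA).
Qed.

Lemma continuous_inv_induced_metric y : D y -> {for y, continuous (fun z => invmx (gind z))}.
Proof.
move=> Dy.
have cT := continuous_jacobian Dy; have cG := continuous_along Dy (cc_smoothG cc).
have FF := nbhs_filter y.
apply: (cvg_invmx FF (induced_metric_unit Dy)
  (near_open oD Dy (fun z Dz => induced_metric_unit Dz))).
exact: (cvg_mulmx FF (cvg_mulmx FF cT cG) (cvg_trmx FF cT)).
Qed.

Lemma continuous_induced_endo y : D y -> {for y, continuous induced_endo}.
Proof.
move=> Dy.
have cT := continuous_jacobian Dy; have cG := continuous_along Dy (cc_smoothG cc).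
have cP := continuous_along Dy (cc_smoothP cc).
have FF := nbhs_filter y.
have cTPG := cvg_mulmx FF (cvg_mulmx FF cT cP) cG.
exact: (cvg_mulmx FF (cvg_mulmx FF cTPG (cvg_trmx FF cT)) (continuous_inv_induced_metric Dy)).
Qed.

Lemma continuous_reeb_trace y : D y -> {for y, continuous reeb_trace}.
Proof.
move=> Dy; have cT := continuous_jacobian Dy; have ci := continuous_inv_induced_metric Dy.
have H (a : 'rV[R]_m -> 'cV[R]_m) : smooth_on E a ->
   {for y, continuous (fun z => ev (T z *m a (F z)) ((T z *m a (F z))^T *m invmx (gind z)))}.
  move=> sa; have ca := continuous_along Dy sa.
  have cTa := cvg_mulmx (nbhs_filter y) cT ca.
  have cM := cvg_mulmx (nbhs_filter y) (cvg_trmx (nbhs_filter y) cTa) ci.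
  exact: cvg_mx_entry (cvg_mulmx (nbhs_filter y) cM cTa).
exact: (@cvgD _ R^o _ _ _ _ _ _ _ (H a1 (cc_smooth1 cc)) (H a2 (cc_smooth2 cc))).
Qed.

(** A continuous function with values in the integers 0, 1 and 2. *)
Lemma reeb_trace_locally_constant y : D y ->
  \forall z \near y, D z /\ reeb_trace z = reeb_trace y.
Proof.
move=> Dy.
have int z : D z -> exists k : nat, reeb_trace z = k%:R.
  move=> Dz; rewrite (reeb_traceE Dz).
  have [h1 h2 h3] := reeb_proj_idem (F_free Dz) (induced_endoP Dz : T z *m jP (jet_along Dz) = _).
  have [[-> _ ->]|[-> _ ->]|->] := idempotent22_trace h1 h2 h3.
  - by exists 0%N; rewrite addr0.
  - by exists 2%N.
  - by exists 1%N.
have nt : \forall z \near y, `|reeb_trace y - reeb_trace z| < 1.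
  by have /cvgrPdist_lt := continuous_reeb_trace Dy; apply.
have FF := nbhs_filter y.
apply: (@filterS _ _ FF _ _ _
  (@filterI _ _ FF _ _ nt (open_nbhs_nbhs (conj oD Dy)))) => z [zy Dz].
split; first exact: Dz.
have [k Ek] := int y Dy; have [l El] := int z Dz.
move: zy; rewrite Ek El -[k%:R]/(k%:~R) -[l%:R]/(l%:~R) -intrB -intr_norm.
rewrite -[1]/(1%:~R) ltr_int => kl.
by congr (_ %:R); lia.
Qed.

Section AlongPoint.
Variables (y : 'rV[R]_n) (Dy : D y).
Local Notation J := (jet_along Dy).

Lemma tangent_inv_along : T y *m jP J = induced_endo y *m T y.
Proof. exact: induced_endoP. Qed.

(** Pair the invariance [phi F_u = F_(Q u)] at nearby points with the fixed covector
    [g(., mu)] of the base point.  The right-hand side is then a product whose second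
    factor [g(F_., mu)] vanishes at the base point, so that [Q] contributes no
    derivative. *)
Lemma invariance_deriv_along mu u v : normal_vec J (T y) mu ->
  - bilin (jG J) (second_derive F y v u) (mu *m jP J) +
    bilin (jG J) (u *m T y *m jdP J (v *m T y)) mu =
  bilin (jG J) (second_derive F y v (u *m induced_endo y)) mu.
Proof.
move=> nmu.
have dF := F_diff oD sF Dy.
have dP := smooth_on_differentiable (cc_open cc) (cc_smoothP cc) (DE Dy).
have dPF : differentiable (fun z => P (F z)) y := differentiable_comp dF dP.
have dT := smooth_on_differentiable oD (smooth_jacobian oD sF) Dy.
pose n0 : 'cV[R]_m := G (F y) *m mu^T.
have dc p q (A : 'M[R]_(p, q)) : differentiable (fun _ : 'rV[R]_n => A) y.
  exact: differentiable_cst.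
have Tn0 : T y *m n0 = 0.
  apply: ev_inj => w; rewrite [RHS]/ev mulmx0 [RHS]mxE /ev /n0 !mulmxA.
  exact: nmu w.
have dTn := differentiable_mulmx dT (dc _ _ n0).
have du := DF_diff oD sF Dy u.
have duP := differentiable_mulmx du dPF.
have eqD : 'D_v (fun z => ('D_u F z *m P (F z)) *m n0) y =
    'D_v (fun z => (u *m induced_endo z) *m (T z *m n0)) y.
  apply: (derive_eq_on v oD Dy) => z Dz.
  have TP : u *m T z *m P (F z) = u *m induced_endo z *m T z.
    by rewrite -mulmxA (induced_endoP Dz) mulmxA.
  by rewrite -(jac_derive oD sF Dz) TP -[LHS]mulmxA.
have cQ : {for y, continuous (fun z => u *m induced_endo z)}.
  have FF := nbhs_filter y.
  exact: (cvg_mulmx FF (cvg_cst u) (continuous_induced_endo Dy)).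
have ER := derive_mulmx_zero v cQ dTn Tn0.
have ET := derive_mulmxr n0 v dT.
have EL := derive_mulmxr n0 v duP.
rewrite (derive_mulmx v du dPF) (derive_chain v dF dP) in EL.
have EQ : second_derive F y v (u *m induced_endo y) =
    u *m induced_endo y *m 'D_v (fun z => T z) y.
  have dq : 'D_v (fun z => (u *m induced_endo y) *m T z) y =
      u *m induced_endo y *m 'D_v (fun z => T z) y.
    exact: derive_mulmxl.
  apply: (etrans _ dq); apply: (derive_eq_on v oD Dy) => z Dz.
  by rewrite (jac_derive oD sF Dz).
have /matrixP /(_ 0 0) E0 := etrans (esym EL) (etrans eqD ER).
have {}E0 : (('D_v (fun z => 'D_u F z) y *m P (F y) +
    'D_u F y *m 'D_('D_v F y) P (F y)) *m n0) 0 0 =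
    (second_derive F y v (u *m induced_endo y) *m n0) 0 0.
  apply: (etrans E0); rewrite EQ -[in RHS]mulmxA; congr ((_ *m _) 0 0); exact: ET.
rewrite -jP_skew -bilinDl (jac_derive oD sF Dy) (jac_derive oD sF Dy).
by move: E0; rewrite /n0 !mulmxA.
Qed.

Lemma is_derive_pull1 w u : is_derive y w (fun z => ev (a1 (F z)) ('D_u F z))
  (pull1_deriv J (T y) (second_derive F y) w u).
Proof.
have da := smooth_on_differentiable (cc_open cc) (cc_smooth1 cc) (DE Dy).
have := is_derive_ev_along oD sF Dy w u da.
by rewrite /pull1_deriv (jac_derive oD sF Dy) (jac_derive oD sF Dy).
Qed.

Lemma is_derive_pull2 w u : is_derive y w (fun z => ev (a2 (F z)) ('D_u F z))
  (pull2_deriv J (T y) (second_derive F y) w u).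
Proof.
have da := smooth_on_differentiable (cc_open cc) (cc_smooth2 cc) (DE Dy).
have := is_derive_ev_along oD sF Dy w u da.
by rewrite /pull2_deriv (jac_derive oD sF Dy) (jac_derive oD sF Dy).
Qed.

Lemma is_derive_pullW1 w p q :
  is_derive y w (fun z => bilin (dform a1 (F z)) ('D_p F z) ('D_q F z))
  (pullW1_deriv J (T y) (second_derive F y) w p q).
Proof.
have dW := cc_diffW1 cc (DE Dy).
have := is_derive_bilin_along oD sF Dy w p q dW.
by rewrite /pullW1_deriv !(jac_derive oD sF Dy).
Qed.

Lemma is_derive_pullW2 w p q :
  is_derive y w (fun z => bilin (dform a2 (F z)) ('D_p F z) ('D_q F z))
  (pullW2_deriv J (T y) (second_derive F y) w p q).
Proof.
have dW := cc_diffW2 cc (DE Dy).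
have := is_derive_bilin_along oD sF Dy w p q dW.
by rewrite /pullW2_deriv !(jac_derive oD sF Dy).
Qed.

Lemma pull1_along u : ev (pull1 J (T y)) u = ev (a1 (F y)) ('D_u F y).
Proof. by have [-> _] := pull_ev J (T y) u; rewrite (jac_derive oD sF Dy). Qed.
Lemma pull2_along u : ev (pull2 J (T y)) u = ev (a2 (F y)) ('D_u F y).
Proof. by have [_ ->] := pull_ev J (T y) u; rewrite (jac_derive oD sF Dy). Qed.

Lemma pullW1_along p q : bilin (jW1 J) (p *m T y) (q *m T y) =
  bilin (dform a1 (F y)) ('D_p F y) ('D_q F y).
Proof. by congr (bilin _ _ _); exact: (jac_derive oD sF Dy). Qed.
Lemma pullW2_along p q : bilin (jW2 J) (p *m T y) (q *m T y) =
  bilin (dform a2 (F y)) ('D_p F y) ('D_q F y).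
Proof. by congr (bilin _ _ _); exact: (jac_derive oD sF Dy). Qed.

End AlongPoint.

Lemma minor_deriv_along (U : set 'rV[R]_n) : open U -> (forall z, U z -> D z) ->
  (forall z, U z -> reeb_trace z = 1) ->
  forall y (Dy : D y), U y -> forall w u v,
  pull1_deriv (jet_along Dy) (T y) (second_derive F y) w u * ev (pull2 (jet_along Dy) (T y)) v +
  ev (pull1 (jet_along Dy) (T y)) u * pull2_deriv (jet_along Dy) (T y) (second_derive F y) w v =
  pull1_deriv (jet_along Dy) (T y) (second_derive F y) w v * ev (pull2 (jet_along Dy) (T y)) u +
  ev (pull1 (jet_along Dy) (T y)) v * pull2_deriv (jet_along Dy) (T y) (second_derive F y) w u.
Proof.
move=> oU UD tr1 y Dy Uy w u v; rewrite !pull1_along !pull2_along.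
apply: (is_derive_prod_eq oU Uy _ (is_derive_pull1 Dy w u) (is_derive_pull2 Dy w v)
  (is_derive_pull1 Dy w v) (is_derive_pull2 Dy w u)) => z Uz.
have Dz := UD z Uz.
have tz : reeb_proj11 (jet_along Dz) (T z) + reeb_proj22 (jet_along Dz) (T z) = 1.
    by rewrite -reeb_traceE tr1.
by have := minor_zero (F_free Dz) (tangent_inv_along Dz) tz u v; rewrite !pull1_along !pull2_along.
Qed.

(** The three cases are those of the dimension of the intersection of the tangent space
    with the Reeb plane, which is constant near [y]; this is what allows the relations
    between the pulled back forms to be differentiated. *)
Lemma alpha_normal_along y (Dy : D y) : (1 < n)%N ->
  alpha_normal (jet_along Dy) (T y) (second_derive F y).
Proof.
move=> n1.
have Hsym u v := second_derive_sym oD sF Dy u v.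
have Hlin c u v w := second_derive_lin oD sF Dy c u v w.
have [h1 h2 h3] := reeb_proj_idem (F_free Dy) (tangent_inv_along Dy).
have [U [[oU Uy] US]] : exists U, open_nbhs y U /\
    U `<=` [set z | D z /\ reeb_trace z = reeb_trace y].
  by have := reeb_trace_locally_constant Dy; rewrite /prop_near1 nbhsE => -[U ? ?]; exists U.
have UD z : U z -> D z by move=> /US[].
have trU z : U z -> reeb_trace z = reeb_trace y by move=> /US[].
have [[e1 e2 e3]|[e1 e2 e3]|tr1] := idempotent22_trace h1 h2 h3.
- exfalso.
  have tr0 : reeb_trace y = 0 by rewrite reeb_traceE e1 e3 addr0.
  have ta0 z : U z -> forall u, ev (a1 (F z)) ('D_u F z) = 0 /\ ev (a2 (F z)) ('D_u F z) = 0.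
    move=> Uz u; have Dz := UD z Uz.
    have [k1 k2 k3] := reeb_proj_idem (F_free Dz) (tangent_inv_along Dz).
    have tz : reeb_proj11 (jet_along Dz) (T z) + reeb_proj22 (jet_along Dz) (T z) = 0.
      by rewrite -reeb_traceE trU.
    have [d1 d2] := pull_decomp (F_free Dz) (tangent_inv_along Dz) u.
    rewrite -(pull1_along Dz) -(pull2_along Dz).
    have [[f1 f2 f3]|[f1 f2 f3]|f] := idempotent22_trace k1 k2 k3.
    + by rewrite d1 d2 f1 f2 f3 !mulr0 addr0.
    + by move: tz; rewrite f1 f3 => /eqP; rewrite -[_ + _]/(2%:R) pnatr_eq0.
    + by move: tz; rewrite f => /eqP; rewrite oner_eq0.
  apply: (alpha_zero_absurd (F_free Dy) (tangent_inv_along Dy) Hsym e1 e3 (ltnW n1)) => w u.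
  have [_ E1] := is_derive_pull1 Dy w u; have [_ E2] := is_derive_pull2 Dy w u.
  have Z f : (forall z, U z -> f z = 0) -> 'D_w f y = 0 :> R.
    by move=> f0; rewrite (derive_eq_on w oU Uy f0) derive_cst.
  by rewrite -E1 -E2; split; apply: Z => z Uz; have [] := ta0 z Uz u.
- exact: (alpha_normal_full (F_free Dy) (tangent_inv_along Dy)).
(* First order at every point of [U] gives the proportionality of the exterior
   derivatives on [U], which is then differentiated at [y]. *)
have trU1 z : U z -> reeb_trace z = 1 by move=> Uz; rewrite trU // reeb_traceE.
apply: (alpha_normal_rank1 (F_free Dy) (tangent_inv_along Dy) Hlin Hsym tr1 _ n1) => w u.
  exact: (minor_deriv_along oU UD trU1 Dy Uy w u).
move=> p q.
have eqU z : U z -> ev (a2 (F z)) ('D_u F z) * bilin (dform a1 (F z)) ('D_p F z) ('D_q F z) =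
    ev (a1 (F z)) ('D_u F z) * bilin (dform a2 (F z)) ('D_p F z) ('D_q F z).
  move=> Uz; have Dz := UD z Uz.
  have Hsz s t := second_derive_sym oD sF Dz s t.
  have tz : reeb_proj11 (jet_along Dz) (T z) + reeb_proj22 (jet_along Dz) (T z) = 1.
    by rewrite -reeb_traceE trU1.
  have W := W_proportional (F_free Dz) (tangent_inv_along Dz) Hsz tz
    (minor_deriv_along oU UD trU1 Dz Uz) u p q.
  exact: (etrans (etrans (congr2 *%R (esym (pull2_along Dz u)) (esym (pullW1_along Dz p q))) W)
    (congr2 *%R (pull1_along Dz u) (pullW2_along Dz p q))).
have S := is_derive_prod_eq oU Uy eqU (is_derive_pull2 Dy w u) (is_derive_pullW1 Dy w p q)
  (is_derive_pull1 Dy w u) (is_derive_pullW2 Dy w p q).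
apply: (etrans (congr2 +%R (congr2 *%R erefl (pullW1_along Dy p q))
  (congr2 *%R (pull2_along Dy u) erefl))).
apply: (etrans S).
exact: (esym (congr2 +%R (congr2 *%R erefl (pullW2_along Dy p q))
  (congr2 *%R (pull1_along Dy u) erefl))).
Qed.

Lemma sff_trace_along y (Dy : D y) nu : (1 < n)%N -> normal_vec (jet_along Dy) (T y) nu ->
  \sum_a \sum_b invmx (gind y) a b *
    sff (jet_along Dy) (T y) (second_derive F y) nu (delta_mx 0 a) (delta_mx 0 b) = 0.
Proof.
move=> n1 nnu.
apply: (sff_trace (F_free Dy) (tangent_inv_along Dy) (second_derive_lin oD sF Dy)
  (second_derive_sym oD sF Dy) nnu).
  by move=> mu u v; exact: invariance_deriv_along.
exact: alpha_normal_along.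
Qed.

End InvariantMap.

(** * From the trace identity to the mean curvature *)

Section Normal.
Variables (R : realType) (n m : nat) (G : 'M[R]_m) (T : 'M[R]_(n, m)).
Hypotheses (G_sym : G^T = G) (G_pos : forall v, v != 0 -> 0 < bilin G v v).

Lemma bilin_eq0 v : bilin G v v = 0 -> v = 0.
Proof. by move=> v0; apply/eqP/negP => /negP/G_pos; rewrite v0 ltxx. Qed.

Lemma posdef_unit : G \in unitmx.
Proof.
rewrite -row_free_unit; apply: inj_row_free => u uG.
by apply: bilin_eq0; rewrite /bilin uG mul0mx mxE.
Qed.

Lemma cap_normal_tangent : (kermx (G *m T^T) :&: <<T>>)%MS = 0.
Proof.
apply/eqP; rewrite -submx0; apply/rV_subP => v; rewrite sub_capmx genmxE.
move=> /andP[/sub_kermxP vK /submxP[u vT]].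
suff -> : v = 0 by exact: sub0mx.
apply: bilin_eq0; rewrite /bilin {2}vT trmx_mul.
by rewrite -mulmxA (mulmxA G) (mulmxA v) vK mul0mx mxE.
Qed.

(** A vector orthogonal to all normal vectors is tangent: it is orthogonal to its own
    normal component. *)
Lemma orthogonal_sub (h : 'rV[R]_m) : T *m G *m T^T \in unitmx ->
  (forall nu : 'rV[R]_m, (forall u, bilin G (u *m T) nu = 0) -> bilin G h nu = 0) ->
  (h <= T)%MS.
Proof.
move=> gu H.
pose c := h *m G *m T^T *m invmx (T *m G *m T^T).
pose nu := h - c *m T.
have nuT : nu *m G *m T^T = 0.
  by rewrite /nu !mulmxBl -!(mulmxA c) /c mulmxKV // subrr.
have nuN u : bilin G (u *m T) nu = 0.
  rewrite (bilin_sym _ _ G_sym) /bilin trmx_mul mulmxA nuT mul0mx mxE //.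
have /bilin_eq0 nu0 : bilin G nu nu = 0.
  by rewrite {1}/nu bilinDl bilinNl nuN (H _ nuN) subr0.
have -> : h = c *m T by apply/eqP; rewrite -subr_eq0 -/nu nu0.
exact: submxMl.
Qed.
End Normal.

Section Christoffel.
Variables (R : realType) (m : nat) (E : set 'rV[R]_m).
Variables (G P : 'rV[R]_m -> 'M[R]_m) (a1 a2 : 'rV[R]_m -> 'cV[R]_m).
Variables (Z1 Z2 : 'rV[R]_m -> 'rV[R]_m).
Hypothesis cc : contact_chart E G P a1 a2 Z1 Z2.
Variables (x : 'rV[R]_m) (Ex : E x).
Local Notation J := (jet_at cc Ex).

Lemma derive_metric_entry (w : 'rV[R]_m) i k :
  bilin (jdG J w) (delta_mx 0 i) (delta_mx 0 k) = 'D_w (fun y => G y i k) x.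
Proof.
have dG := cc_diffG cc Ex.
by rewrite /bilin -rowE trmx_delta -colE -(derive_entry w i k dG) !mxE.
Qed.

Lemma jgamma_delta i k s : jgamma J (delta_mx 0 i) (delta_mx 0 k) (delta_mx 0 s) =
  2^-1 * (pderiv i (fun y => G y k s) x + pderiv k (fun y => G y i s) x
    - pderiv s (fun y => G y i k) x).
Proof. by congr (_ * (_ + _ - _)); exact: derive_metric_entry. Qed.

(** Lowering the index of the Christoffel symbols cancels the inverse of the metric. *)
Lemma christoffel_lower i k w :
  bilin (G x) (christoffel G x i k) w = jgamma J (delta_mx 0 i) (delta_mx 0 k) w.
Proof.
have gu : G x \in unitmx := posdef_unit (cc_pos cc Ex).
set ei := delta_mx 0 i; set ek := delta_mx 0 k.
rewrite (row_expand (f := jgamma J ei ek) w (jgammaDr J ei ek) (fun c => jgammaZr J c ei ek)).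
pose c : 'rV[R]_m := \row_l jgamma J ei ek (delta_mx 0 l).
have cE : christoffel G x i k = c *m invmx (G x).
  apply/rowP => l; rewrite !mxE mulr_sumr; apply: eq_bigr => s _.
  rewrite mxE jgamma_delta.
  have -> : invmx (G x) l s = invmx (G x) s l.
    by rewrite -{1}(cc_sym cc Ex) -trmx_inv mxE.
  exact: (etrans (mulrCA _ _ _) (mulrC _ _)).
rewrite cE /bilin mulmxKV // mxE; apply: eq_bigr => l _.
by rewrite !mxE mulrC.
Qed.

Lemma covariant_derivative_lower n (F : 'rV[R]_n -> 'rV[R]_m) y (a b : 'I_n) nu :
  F y = x ->
  bilin (G x) (covariant_derivative G F y a b) nu =
  bilin (G x) (pderiv a (pderiv b F) y) nu + jgamma J (pderiv a F y) (pderiv b F y) nu.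
Proof.
move=> Fyx; rewrite /covariant_derivative Fyx bilinDl; congr (_ + _).
set Fa := pderiv a F y; set Fb := pderiv b F y.
rewrite (row_expand (f := fun u => jgamma J u Fb nu) Fa
  (fun u v => jgammaDl J u v Fb nu) (fun c v => jgammaZl J c v Fb nu)).
rewrite bilin_suml; apply: eq_bigr => i _; set ei := delta_mx 0 i.
rewrite jgamma_sym (row_expand (f := fun u => jgamma J u ei nu) Fb
  (fun u v => jgammaDl J u v ei nu) (fun c v => jgammaZl J c v ei nu)).
rewrite bilin_suml mulr_sumr; apply: eq_bigr => k _.
by rewrite bilinZl christoffel_lower jgamma_sym mulrA.
Qed.

End Christoffel.

(** The trace of the covariant derivative is orthogonal to the normal vectors, so it is
    tangent, and the normal projection kills it. *)
Theorem invariant_map_mean_curvature (R : realType) (n m : nat) (D : set 'rV[R]_n)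
    (E : set 'rV[R]_m) (G P : 'rV[R]_m -> 'M[R]_m) (a1 a2 : 'rV[R]_m -> 'cV[R]_m)
    (Z1 Z2 : 'rV[R]_m -> 'rV[R]_m) (F : 'rV[R]_n -> 'rV[R]_m) :
  contact_chart E G P a1 a2 Z1 Z2 ->
  open D -> smooth_on D F -> (forall y, D y -> E (F y)) ->
  (forall y, D y -> row_free (jacobian F y)) ->
  (forall y, D y -> stablemx (jacobian F y) (P (F y))) ->
  (1 < n)%N -> forall y, D y -> mean_curvature G F y = 0.
Proof.
move=> cc oD sF DE F_free F_stable n1 y Dy.
have Ey := DE y Dy.
have gu := induced_metric_unit cc DE F_free Dy.
have K0 := cap_normal_tangent (jacobian F y) (cc_pos cc Ey).
pose h := \sum_a \sum_b invmx (induced_metric G F y) a b *: covariant_derivative G F y a b.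
have hT : (h <= jacobian F y)%MS.
  apply: (orthogonal_sub (cc_sym cc Ey) (cc_pos cc Ey) gu) => nu nuN.
  have := sff_trace_along oD sF F_free F_stable n1 (nuN : normal_vec (jet_along cc DE Dy) _ nu).
  move=> S; rewrite -[RHS]S /h bilin_suml; apply: eq_bigr => a _.
  rewrite bilin_suml; apply: eq_bigr => b _.
  rewrite bilinZl (covariant_derivative_lower cc Ey _ _ _ erefl).
  by rewrite /sff !(jac_derive oD sF Dy).
have -> : mean_curvature G F y = n%:R^-1 *: (h *m normal_projection G F y).
  rewrite /mean_curvature /h mulmx_suml; congr (_ *: _); apply: eq_bigr => a _.
  rewrite mulmx_suml; apply: eq_bigr => b _.
  by rewrite -scalemxAl.
rewrite /normal_projection proj_mx_0 ?scaler0 //.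
by rewrite genmxE.
Qed.

(** In the chart, the domain is the preimage of an open set under [cinv c], which is
    continuous on the image of the chart only. *)
Lemma chart_map_dom_open (R : realType) (n m : nat) (N : smooth_manifold R n)
    (M : smooth_manifold R m) (f : N -> M) (c : chart N) (d : chart M) :
  continuous f -> open (chart_map_dom f c d).
Proof.
move=> cf.
have -> : chart_map_dom f c d =
    [set y | cimage c y /\ (cdom c `&` f @^-1` cdom d) (cinv c y)].
  apply/seteqP; split=> y /=.
    by move=> [p [cp fp] <-]; rewrite cmapK //; split=> //; exists p.
  by move=> [[p cp <-]]; rewrite cmapK // => cfp; exists p.
rewrite openE => y [cy Hy].
have o : open (cdom c `&` f @^-1` cdom d).
  by apply: openI; [exact: cdom_open | apply: open_comp (cdom_open d) => ? _; exact: cf].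
have n1 : nbhs y (cimage c) by apply: open_nbhs_nbhs; split=> //; exact: cmap_open.
have n2 := cinv_continuous cy (open_nbhs_nbhs (conj o Hy)).
exact: filterI n1 n2.
Qed.

Lemma contact_chart_of (R : realType) (h k m : nat) (M : smooth_manifold R m)
    (alpha1 alpha2 : one_form M) (Z1 Z2 : vector_field M) (phi : endo_field M)
    (g : riemannian_metric M) (d : chart M) :
  metric_contact_pair h k alpha1 alpha2 Z1 Z2 phi g ->
  contact_chart (cimage d) (g d) (phi d) (alpha1 d) (alpha2 d) (Z1 d) (Z2 d).
Proof.
move=> [[_ reeb phiE] assoc].
split.
- exact: cmap_open.
- exact: Defs.metric_smooth.
- exact: endo_smooth.
- exact: oform_smooth.
- exact: oform_smooth.
- exact: Defs.metric_sym.
- exact: Defs.metric_pos.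
- by move=> x /reeb[].
- by move=> x /reeb[_ r1 r2 r3 r4] v; split.
- by move=> x /phiE[].
- by move=> x /phiE[].
- by move=> x /assoc[].
- by move=> x /assoc[_ h1 h2] u; split.
Qed.

Theorem theorem15 (R : realType) (h k : nat)
    (M : smooth_manifold R (2 * h + 2 * k + 2))
    (alpha1 alpha2 : one_form M) (Z1 Z2 : vector_field M)
    (phi : endo_field M) (g : riemannian_metric M)
    (hM : metric_contact_pair h k alpha1 alpha2 Z1 Z2 phi g)
    (hnormal : normal_structure alpha1 alpha2 Z1 Z2 phi)
    (hdec : decomposable alpha1 alpha2 phi)
    (n : nat) (N : smooth_manifold R n) (f : N -> M)
    (hsub : submanifold f) (hinv : phi_invariant f phi) (hn : (2 <= n)%N) :
  minimal f g.
Proof.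
move=> c d y cdy; have [_ f_cont f_smooth f_immersion] := hsub.
have cc := contact_chart_of d hM.
have oD : open (chart_map_dom f c d) by exact: chart_map_dom_open.
apply: (invariant_map_mean_curvature cc oD (f_smooth c d) _ _ _ hn).
- by move=> z [p [cp dfp] <-]; exists (f p) => //; rewrite /chart_map /= cmapK.
- exact: f_immersion.
- exact: hinv.
- exact: cdy.
Qed.
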